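(* Let $\tilde Q_{\mathbb{Z}}$ be a non-deterministic Extended Ergodic CP Distribution on $\tilde X_{\mathbb{Z}}$ and let $\tilde Q=\tilde\pi_-\tilde Q_{\mathbb{Z}}$ be its pushforward to $\tilde X$. Let $T$ be the ($\tilde Q$-a.e. defined, invertible) transformation of $\tilde Y=\{(\nu,\boldsymbol{i}_-)\in\tilde X:\nu[0,1)\ne0\}$ given by $T(\nu,\boldsymbol{i}_-)=T_{\tau(\nu)}(\nu,\boldsymbol{i}_-)$, where $\tau(\nu)=\min\{n\in\mathbb{N}:t_n\nu[0,1)>0\}$. Then $T$ is a non-singular transformation with respect to $\tilde Q$ (i.e. $T\tilde Q\sim\tilde Q$), and $\varphi\equiv\frac{dT^{-1}\tilde Q}{d\tilde Q}$ is given by $$\varphi(\nu,\boldsymbol{i}_-)=\nu[\tau(\nu),\tau(\nu)+1).$$ Here $T\tilde Q$ and $T^{-1}\tilde Q$ denote the pushforwards of $\tilde Q$ by $T$ and by $T^{-1}$.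
   Context: All spaces are separable metric spaces with their Borel $\sigma$-algebras. $\mathcal{M}(\mathbb{R})$: positive Radon measures on $\mathbb{R}$ (including $0$), weak topology. $\rho\nu$ denotes pushforward. $\mathbb{N}=\{1,2,\ldots\}$. For $0\ne\nu\in\mathcal{M}(\mathbb{R})$, $\psi(\nu)=\min\{n\in\mathbb{N}:\nu[-(n-1),n)>0\}$, $N\nu=\nu/\nu[-(\psi(\nu)-1),\psi(\nu))$; $N0=0$. $\mathcal{M}^*=N(\mathcal{M}(\mathbb{R}))$. Fix $p\ge2$, $\Lambda_p=\{0,\ldots,p-1\}$, $[j)_p=[\frac jp,\frac{j+1}p)$, $\rho_j(x)=px-j$. Write $\boldsymbol{i}=(i_n)_{n\in\mathbb{Z}}$, $\boldsymbol{i}_-=(i_n)_{n\le0}$; $(\boldsymbol{\sigma}(\boldsymbol{i}))_n=i_{n+1}$. On $\mathcal{M}^*\times\Lambda_p^{\mathbb{Z}}$: $\hat\nu(\nu,\boldsymbol{i})=\nu$, $\hat i_n(\nu,\boldsymbol{i})=i_n$, $M_p(\nu,\boldsymbol{i})=(N\rho_{i_1}\nu,\boldsymbol{\sigma}(\boldsymbol{i}))$. A Borel probability measure $\tilde Q_{\mathbb{Z}}$ is adapted if for every $j\in\Lambda_p$ and a.e. $(\nu,\boldsymbol{i})$, $\mathbb{P}_{\tilde Q_{\mathbb{Z}}}(\hat i_1=j\mid\hat\nu,(\hat i_n)_{n\le0})(\nu,\boldsymbol{i})=\nu[j)_p$; it is an Extended Ergodic CP Distribution if it is adapted and invariant and ergodic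 under $M_p$; it is deterministic if $\mathbb{P}_{\tilde Q_{\mathbb{Z}}}(\hat i_1=i_1\mid\hat\nu,(\hat i_n)_{n\le0})(\nu,\boldsymbol{i})=1$ for a.e. $(\nu,\boldsymbol{i})$, otherwise non-deterministic. Let $E_j=\{\boldsymbol{i}:i_n=j\text{ for all sufficiently negative }n\}$ and $\tilde X_{\mathbb{Z}}=\{(\nu,\boldsymbol{i}):\nu\in\mathcal{M}^*,\ \boldsymbol{i}\notin E_j\ \forall j\in\Lambda_p\}$; non-deterministic Extended ECPDs are supported on $\tilde X_{\mathbb{Z}}$. $\tilde\pi_-(\nu,\boldsymbol{i})=(\nu,\boldsymbol{i}_-)$, $\tilde X=\tilde\pi_-\tilde X_{\mathbb{Z}}$. Translations: $t_x(y)=y-x$, $t_x^*\nu=Nt_x\nu$. For an interval $I=[a,b)$ and $j\in\Lambda_p$, $I^j=[a+\frac{j(b-a)}p,a+\frac{(j+1)(b-a)}p)$. The well based sequence compatible with $\boldsymbol{i}_-$ is the unique $(I_n)_{n\le0}$ with $I_0=[0,1)$ and $I_n^{i_{n+1}}=I_{n+1}$ for $n<0$; when $\boldsymbol{i}_-$ is not eventually (as $n\to-\infty$) constantly $0$ or $p-1$, $\bigcup_nI_n=\mathbb{R}$. For such $\boldsymbol{i}_-$ and $k\in\mathbb{Z}$, choose $n_0\le0$ with $[k,k+1)\subseteq I_{n_0}$ and $j_{n_0+1},\ldots,j_0\in\Lambda_p$ with $[k,k+1)=(\cdots((I_{n_0}^{j_{n_0+1}})^{j_{n_0+2}})\cdots)^{j_0}$;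 set $s_k(\boldsymbol{i}_-)_m=i_m$ for $m\le n_0$ and $=j_m$ for $n_0<m\le0$ (independent of the choice of $n_0$). Then $T_k(\nu,\boldsymbol{i}_-)=(t_k^*\nu,s_k(\boldsymbol{i}_-))$ on $\tilde X$. The set $\tilde Y$ has full $\tilde Q$-measure; $\tau(\nu)<\infty$ for a.e. $(\nu,\boldsymbol{i}_-)$, and $T^{-1}(\nu,\boldsymbol{i}_-)=T_{-\tau_-(\nu)}(\nu,\boldsymbol{i}_-)$ a.e., where $\tau_-(\nu)=\min\{n\in\mathbb{N}:t_{-n}\nu[0,1)>0\}$. *)

(* Defs.v *)
From HB Require Import structures.
From mathcomp Require Import all_boot all_order all_algebra.
From mathcomp Require Import all_classical all_reals all_analysis.
From mathcomp Require Import measurable_realfun.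

Set Implicit Arguments.
Unset Strict Implicit.
Unset Printing Implicit Defensive.

Import Order.TTheory GRing.Theory Num.Theory.
Import numFieldNormedType.Exports.

Local Open Scope classical_set_scope.
Local Open Scope ring_scope.

Notation borel X := (g_sigma_algebraType (@open X)).

(* Every set function in the library is defined on all subsets of the line.
   radon_measurable fixes its value off the Borel sets, so that two elements of
   radon R are equal as soon as they agree on Borel sets. On the line a Borel
   measure that is finite on compact sets is automatically regular. *)
Record radon (R : realType) := Radon {
  radon_measure :> {measure set R -> \bar R} ;
  radon_compact : forall K : set R, compact K -> (radon_measure K < +oo)%E ;
  radon_measurable : forall A : set R, ~ measurable A -> radon_measure A = 0%E }.

Section radon_constructions.
Variable R : realType.

Definition radon_zero : radon R.
Proof. by exists (@mzero _ R R) => // K _; rewrite /mzero ltry. Defined.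

Section image.
Variables (f g : R -> R) (nu : radon R).
Hypotheses (cf : continuous f) (cg : continuous g).
Hypotheses (fK : cancel f g) (gK : cancel g f).

Let mf : measurable_fun [set: R] f.
Proof. exact: continuous_measurable_fun. Qed.

Definition radon_image : radon R.
Proof.
unshelve refine (@Radon R (pushforward nu f : {measure set R -> \bar R}) _ _).
exact: mf.
- move=> K cK; apply: radon_compact.
  suff -> : f @^-1` K = g @` K.
    by apply: continuous_compact => //; exact: continuous_subspaceT.
  apply/seteqP; split=> [x Kfx|_ [y Ky <-]]; last by rewrite /preimage /= gK.
  by exists (f x).
- move=> A nmA; apply: radon_measurable => mfA; apply: nmA.
  suff -> : A = setT `&` g @^-1` (f @^-1` A).
    by apply: continuous_measurable_fun.
  by rewrite setTI; apply/seteqP; split=> x /=; rewrite gK.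
Defined.
End image.

Definition radon_scale (c : {nonneg R}) (nu : radon R) : radon R.
Proof.
exists (mscale c nu).
- by move=> K cK; rewrite /mscale lte_mul_pinfty ?radon_compact.
- by move=> A /radon_measurable nuA0; rewrite -[LHS]/(c%:num%:E * nu A)%E nuA0 mule0.
Defined.

End radon_constructions.

HB.instance Definition _ (R : realType) := gen_eqMixin (radon R).
HB.instance Definition _ (R : realType) := gen_choiceMixin (radon R).
HB.instance Definition _ (R : realType) :=
  isPointed.Build (radon R) (radon_zero R).

Definition Cc (R : realType) : Type :=
  {f : R -> R | continuous f /\ compact (closure [set x | f x != 0])}.

Definition radon_pairing (R : realType) (nu : radon R) :
    {ptws Cc R -> R} := fun f => \int[nu]_x sval f x.

(* The weak topology: the coarsest one for which nu |-> \int f dnu is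
   continuous for every continuous f with compact support. *)
HB.instance Definition _ (R : realType) :=
  Topological.copy (radon R) (initial_topology (@radon_pairing R)).

(* minN P is the least n >= 1 satisfying P, and 0 if there is none. *)
Definition minN (P : nat -> Prop) : nat :=
  xget 0%N [set n | [/\ (0 < n)%N, P n &
                        forall m, (0 < m)%N -> P m -> (n <= m)%N]].

Section measures_on_the_line.
Variable R : realType.
Implicit Types nu : radon R.

Definition unit_itv : set R := `[0, 1[.

Definition window (n : nat) : set R := `[- (n%:R - 1), n%:R[.

Definition psi nu : nat := minN (fun n => (0 < nu (window n))%E).

Definition window_mass nu : R := fine (nu (window (psi nu))).

Lemma window_mass_inv_ge0 nu : 0 <= (window_mass nu)^-1.
Proof. by rewrite invr_ge0 fine_ge0. Qed.

(* For nu = 0 the scaling factor is irrelevant, so that N 0 = 0. *)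
Definition normalize nu : radon R :=
  radon_scale (NngNum (window_mass_inv_ge0 nu)) nu.

Definition mstar : Type := set_type (range normalize).

Definition to_mstar nu : mstar :=
  SigSub (mem_set (imageT normalize nu)).

HB.instance Definition _ := Topological.copy mstar (set_type (range normalize)).
HB.instance Definition _ := isPointed.Build mstar (to_mstar (radon_zero R)).

Definition trans (x y : R) : R := y - x.

Lemma continuous_trans x : continuous (trans x).
Proof. by move=> y; apply: cvgB; [exact: cvg_id|exact: cvg_cst]. Qed.

Lemma transK x : cancel (trans x) (trans (- x)).
Proof. by move=> y; rewrite /trans opprK subrK. Qed.

Lemma transNK x : cancel (trans (- x)) (trans x).
Proof. by move=> y; rewrite /trans opprK addrK. Qed.

Definition trans_image (x : R) nu : radon R :=
  radon_image nu (@continuous_trans x) (@continuous_trans (- x))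
    (@transK x) (@transNK x).

Definition trans_star (x : R) nu : mstar := to_mstar (trans_image x nu).

Definition tau nu : nat :=
  minN (fun n => (0 < trans_image n%:R nu unit_itv)%E).

Definition tau_minus nu : nat :=
  minN (fun n => (0 < trans_image (- n%:R) nu unit_itv)%E).

End measures_on_the_line.

Definition nuhat (R : realType) (X : Type) (w : mstar R * X) : radon R :=
  set_val w.1.

HB.instance Definition _ (n : nat) := isPointed.Build 'I_n.+1 ord0.

(* gc is a version of the conditional probability Q(A | F) given the
   sub-sigma-algebra F. *)
Definition is_cond_prob d (T : measurableType d) (R : realType)
    (Q : probability T R) (F : set (set T)) (A : set T) (gc : T -> \bar R) :=
  [/\ forall B : set (\bar R), measurable B -> F (gc @^-1` B),
      Q.-integrable [set: T] gc &
      forall B, F B -> (\int[Q]_(x in B) gc x)%E = Q (A `&` B)].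

Definition invariant d (T : measurableType d) (R : realType)
    (Q : probability T R) (f : T -> T) :=
  measurable_fun [set: T] f /\
  forall A, measurable A -> pushforward Q f A = Q A.

Definition ergodic d (T : measurableType d) (R : realType)
    (Q : probability T R) (f : T -> T) :=
  forall A, measurable A -> f @^-1` A = A -> Q A = 0%E \/ Q A = 1%E.

Definition nonsingular d (T : measurableType d) (R : realType)
    (mu : set T -> \bar R) (f : T -> T) :=
  [/\ measurable_fun [set: T] f,
      pushforward mu f `<< mu & mu `<< pushforward mu f].

Definition ae_inverse d (T : measurableType d) (R : realType)
    (mu : set T -> \bar R) (f finv : T -> T) :=
  measurable_fun [set: T] finv /\
  {ae mu, forall x, finv (f x) = x /\ f (finv x) = x}.

(* phi is (a version of) the Radon-Nikodym derivative of nu by mu. *)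
Definition is_density d (T : measurableType d) (R : realType)
    (mu nu : set T -> \bar R) (phi : T -> \bar R) :=
  [/\ measurable_fun [set: T] phi, forall x, (0 <= phi x)%E &
      forall A, measurable A -> nu A = (\int[mu]_(x in A) phi x)%E].

(* An integer p >= 2 is represented as q.+2. *)
Section cp_distributions.
Variables (R : realType) (q : nat).
Local Notation p := q.+2.

Definition digit : Type := discrete_topology 'I_p.
HB.instance Definition _ := Topological.copy digit (discrete_topology 'I_p).
HB.instance Definition _ := Pointed.copy digit (discrete_topology 'I_p).

Definition digit_val (j : digit) : R := (nat_of_ord j)%:R.

Definition digit_itv (j : digit) : set R :=
  `[digit_val j / p%:R, (digit_val j + 1) / p%:R[.

Definition rho (j : digit) (x : R) : R := p%:R * x - digit_val j.
Definition rho_inv (j : digit) (x : R) : R := (x + digit_val j) / p%:R.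

Lemma continuous_rho j : continuous (rho j).
Proof.
move=> x; apply: cvgB; last exact: cvg_cst.
by apply: cvgM; [exact: cvg_cst|exact: cvg_id].
Qed.

Lemma continuous_rho_inv j : continuous (rho_inv j).
Proof.
move=> x; apply: cvgM; last exact: cvg_cst.
by apply: cvgD; [exact: cvg_id|exact: cvg_cst].
Qed.

Lemma rhoK j : cancel (rho j) (rho_inv j).
Proof. by move=> x; rewrite /rho_inv /rho subrK mulrC mulKf// pnatr_eq0. Qed.

Lemma rho_invK j : cancel (rho_inv j) (rho j).
Proof. by move=> x; rewrite /rho_inv /rho mulrC divfK ?pnatr_eq0// addrK. Qed.

Definition rho_image (j : digit) (nu : radon R) : radon R :=
  radon_image nu (@continuous_rho j) (@continuous_rho_inv j)
    (@rhoK j) (@rho_invK j).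

Definition two_sided : Type := {ptws int -> digit}.
HB.instance Definition _ := Topological.copy two_sided {ptws int -> digit}.
HB.instance Definition _ := Pointed.copy two_sided {ptws int -> digit}.

(* A sequence (i_n)_{n <= 0} is stored as the function k |-> i_{-k} on nat. *)
Definition one_sided : Type := {ptws nat -> digit}.
HB.instance Definition _ := Topological.copy one_sided {ptws nat -> digit}.
HB.instance Definition _ := Pointed.copy one_sided {ptws nat -> digit}.

Definition omega_Z : measurableType _ := borel (mstar R * two_sided)%type.
Definition omega_minus : measurableType _ := borel (mstar R * one_sided)%type.

Definition shift (i : two_sided) : two_sided := fun n => i (n + 1).

Definition M_p (w : omega_Z) : omega_Z :=
  (to_mstar (rho_image (w.2 1) (nuhat w)), shift w.2).

Definition past (w : omega_Z) : omega_minus :=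
  (w.1, fun k : nat => w.2 (- k%:Z)).

(* The sigma-algebra generated by nu and the digits i_n with n <= 0. *)
Definition past_algebra : set (set omega_Z) := g_sigma_algebra_preimage past.

Definition next_digit_is (j : digit) : set omega_Z := [set w | w.2 1 = j].

Section distributions.
Variable Q : probability omega_Z R.

Definition adapted :=
  forall j : digit, exists2 gc : omega_Z -> \bar R,
    is_cond_prob Q past_algebra (next_digit_is j) gc &
    {ae Q, forall w, gc w = nuhat w (digit_itv j)}.

Definition extended_ergodic_CP_distribution :=
  [/\ adapted, invariant Q M_p & ergodic Q M_p].

Definition deterministic :=
  exists2 gc : digit -> omega_Z -> \bar R,
    forall j, is_cond_prob Q past_algebra (next_digit_is j) (gc j) &
    {ae Q, forall w, gc (w.2 1) w = 1%E}.

End distributions.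

Definition eventually_constant (j : digit) : set two_sided :=
  [set i | exists m : int, forall n : int, n <= m -> i n = j].

Definition Xtilde_Z : set omega_Z :=
  [set w | forall j, ~ eventually_constant j w.2].

Definition Xtilde : set omega_minus := past @` Xtilde_Z.

(* A half-open interval [a, b[ is represented by the pair (a, b). *)
Definition itv_of (I : R * R) : set R := `[I.1, I.2[.

Definition subitv (I : R * R) (j : digit) : R * R :=
  (I.1 + digit_val j * (I.2 - I.1) / p%:R,
   I.1 + (digit_val j + 1) * (I.2 - I.1) / p%:R).

(* As for one_sided, the interval I_{-m} is stored as I m. *)
Definition well_based (i : one_sided) (I : nat -> R * R) :=
  I 0%N = (0, 1) /\ forall m, subitv (I m.+1) (i m) = I m.

(* n_0 = - m, and j_{n_0+1}, ..., j_0 are the values s (m-1), ..., s 0. *)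
Definition is_s (k : int) (i s : one_sided) :=
  exists (I : nat -> R * R) (m : nat),
    [/\ well_based i I,
        itv_of (k%:~R, k%:~R + 1) `<=` itv_of (I m),
        foldl subitv (I m) (rev (mkseq s m)) = (k%:~R, k%:~R + 1) &
        forall l, (m <= l)%N -> s l = i l].

(* The only s satisfying is_s k i s, if i is not eventually 0 or p-1. *)
Definition s_ (k : int) (i : one_sided) : one_sided := xget i (is_s k i).

Definition T_ (k : int) (x : omega_minus) : omega_minus :=
  (trans_star k%:~R (nuhat x), s_ k x.2).

Definition Ytilde : set omega_minus :=
  [set x | Xtilde x /\ nuhat x (@unit_itv R) <> 0%E].

(* T and T_inv are extended by the identity outside Ytilde. Where tau (resp.
   tau_minus) is infinite, its value as a minN is 0 and T_ 0 is the identity. *)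
Definition T (x : omega_minus) : omega_minus :=
  if pselect (Ytilde x) then T_ (tau (nuhat x))%:Z x else x.

Definition T_inv (x : omega_minus) : omega_minus :=
  if pselect (Ytilde x) then T_ (- (tau_minus (nuhat x))%:Z) x else x.

Definition phi (x : omega_minus) : \bar R :=
  nuhat x `[(tau (nuhat x))%:R, (tau (nuhat x))%:R + 1[%classic.

End cp_distributions.

(* Main.v *)
From HB Require Import structures.
Require Import Defs.
From mathcomp Require Import all_boot all_order all_algebra.
From mathcomp Require Import all_classical all_reals all_analysis.
From mathcomp Require Import measurable_realfun.
From mathcomp Require Import zify ring lra.

Set Implicit Arguments.
Unset Strict Implicit.
Unset Printing Implicit Defensive.

Import Order.TTheory GRing.Theory Num.Theory.
Import numFieldNormedType.Exports.

Local Open Scope classical_set_scope.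
Local Open Scope ring_scope.

(** Write mu for the law of the past (nu, i_-) and p = q + 2. The proof compares
the laws of a point and of its translates on a coarser scale, where both are
simply two cells of the same interval.

Going back m steps of M_p, a point x is obtained from an earlier point y by
adjoining m digits, and adaptedness together with invariance says that, given
y, the digit word w is chosen with probability nu_y[w), the mass which y gives
to the corresponding p-adic subinterval of [0,1). The measure of x is the
measure of y on that subinterval, blown up and normalized. If k is an integer
and the word w + k (addition in base p) is again a word of length m, then T_k
replaces the word w by w + k and leaves y alone. So the density of the
translated law is the ratio nu_y[w + k) / nu_y[w), which is exactly
nu_x[k, k + 1) because nu_x[0, 1) = 1. This yields, for all nonnegative g,

  \int g(T_k x) nu_x[k, k + 1) dmu = \int g(x) 1{nu_x[-k, -k + 1) > 0} dmu,

first on the event that m digits are enough for the addition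
(translation_law_level, by induction on m, one step being transfer), and then
everywhere by monotone convergence (translation_law), since on Xtilde the
digits are neither eventually 0 nor eventually p - 1 and hence some m suffices.

For almost every x both return times tau and tau_minus are finite. The event
that no unit interval to the right of [0, 1) is charged is carried into itself
by M_p backwards in time, so it has measure 0 or 1 by ergodicity; if it had
measure 1, two charged digits could not coexist and the next digit would be
determined by the past, against the hypothesis that the distribution is not
deterministic. The left side is symmetric (uncharged_side_null).

Finally, T is T_k where tau = k, and T_k exchanges the events tau = k and
tau_minus = k. Applying the translation law to functions supported on
tau_minus = k and summing over k gives mu(A) = \int_{T^-1 A} phi dmu
(return_law). As phi is almost everywhere positive and T_inv is almost
everywhere inverse to T, non-singularity and the formula for the density both
follow from this single identity. *)

(** * Borel maps into products *)

(** Joins the topology and the base point of a product, so that borel (X * Y) is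
    treated like borel X. *)
HB.instance Definition _ (X Y : ptopologicalType) := Pointed.on (X * Y)%type.

Section borel_maps.

Lemma measurable_open (X : ptopologicalType) (U : set X) :
  open U -> measurable (U : set (borel X)).
Proof. exact: sub_sigma_algebra. Qed.

Lemma measurable_fun_borel d (T : measurableType d) (X : ptopologicalType)
    (f : T -> borel X) :
  (forall U : set X, open U -> measurable (f @^-1` U)) ->
  measurable_fun [set: T] f.
Proof.
move=> fo; apply: (@measurability _ _ _ (borel X) _ _ (@open X)) => // _ [U oU <-].
by rewrite setTI; exact: fo.
Qed.

Lemma continuous_borel (X Y : ptopologicalType) (f : X -> Y) :
  continuous f -> measurable_fun [set: borel X] (f : borel X -> borel Y).
Proof.
move=> /continuousP cf; apply: measurable_fun_borel => U oU.
by apply: measurable_open; exact: cf.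
Qed.

Lemma bigcup_countType d (T : measurableType d) (I : countType)
    (F : I -> set T) :
  (forall i, measurable (F i)) -> measurable (\bigcup_i F i).
Proof.
move=> mF.
rewrite (_ : \bigcup_i F i =
    \bigcup_n if unpickle n is Some i then F i else set0).
  by apply: bigcupT_measurable => n; case: unpickle.
apply/seteqP; split=> [x [i _ Fix]|x [n _]].
  by exists (pickle i) => //; rewrite pickleK.
by case: unpickle => // i Fix; exists i.
Qed.

(** An open set of X * Y is the union, over a countable base B of Y, of the
rectangles V i * B i with V i the largest open set whose rectangle fits. A countable
base of one factor is enough, so that the other one may be a space of
measures. *)
Lemma measurable_fun_pair_borel d (T : measurableType d)
    (X Y : ptopologicalType) (I : countType) (B : I -> set Y)
    (f : T -> borel X) (g : T -> Y) :
  (forall i, open (B i)) ->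
  (forall U y, open U -> U y -> exists i, B i y /\ B i `<=` U) ->
  measurable_fun [set: T] f -> (forall i, measurable (g @^-1` B i)) ->
  measurable_fun [set: T] ((fun t => (f t, g t)) : T -> borel (X * Y)%type).
Proof.
move=> oB Bbase mf mg.
apply: (@measurable_fun_borel _ _ (X * Y)%type) => U oU.
pose V i := \bigcup_(W in [set W : set X | open W /\ W `*` B i `<=` U]) W.
have oV i : open (V i) by apply: bigcup_open => W [].
rewrite (_ : _ @^-1` U = \bigcup_i (f @^-1` V i `&` g @^-1` B i)).
  apply: bigcup_countType => i; apply: measurableI; last exact: mg.
  by rewrite -[_ @^-1` _]setTI; apply: mf => //; exact: measurable_open.
apply/seteqP; split=> [t Ut|t [i _ [[W [_ WU] Wf] Bg]]]; last exact: WU.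
have := oU; rewrite openE => /(_ _ Ut)[[P Q] /= [nP nQ] PQU].
move: nP nQ; rewrite !nbhsE => -[P' [oP' P't] PP'] [Q' [oQ' Q't] QQ'].
have [i [Bi BQ]] := Bbase _ _ oQ' Q't.
exists i => //; split=> //; exists P' => //; split=> //.
by move=> [x y] /= [Px By]; apply: PQU; split=> /=; [exact: PP'|exact/QQ'/BQ].
Qed.

Lemma continuous_ptws (X Y : topologicalType) (I : Type)
    (g : X -> {ptws I -> Y}) :
  (forall i, continuous (fun x => g x i)) -> continuous g.
Proof.
move=> cg x; apply/cvg_sup => i A [_ [[B oB <-] Bx BA]].
have := cg i x; move=> /(_ B); rewrite /nbhs/=.
have nB : nbhs (g x i) B by apply: open_nbhs_nbhs.
by move=> /(_ nB); apply: filterS => y By; exact: BA.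
Qed.

Lemma open_rat_itv (R : realType) (x : R) (U : set R) : open U -> U x ->
  exists ab : rat * rat, `]ratr ab.1 : R, ratr ab.2[%classic x /\
                         `]ratr ab.1 : R, ratr ab.2[%classic `<=` U.
Proof.
move=> oU Ux; have := oU; rewrite openE => /(_ _ Ux)/nbhs_ballP[e /= e0 xeU].
have [a] := @rat_in_itvoo R (x - e) x (ltac:(by rewrite gtrBl)).
have [b] := @rat_in_itvoo R x (x + e) (ltac:(by rewrite ltrDl)).
rewrite !in_itv/= => /andP[xb bx] /andP[xa ax].
exists (a, b); split=> /=; first by rewrite in_itv/= ax xb.
move=> y /=; rewrite in_itv/= => /andP[ay yb]; apply: xeU.
by rewrite /ball/= ltr_norml; apply/andP; split; lra.
Qed.

(** Normalization, T, its inverse and phi are all of this form: an integer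
chosen measurably by the point selects one of countably many nicer maps. *)
Lemma measurable_fun_piecewise d d' (T : measurableType d)
    (T' : measurableType d') (n : T -> nat) (F : nat -> T -> T') :
  (forall k, measurable (n @^-1` [set k])) ->
  (forall k, measurable_fun [set: T] (F k)) ->
  measurable_fun [set: T] (fun t => F (n t) t).
Proof.
move=> mn mF _ B mB; rewrite setTI.
rewrite (_ : _ @^-1` B = \bigcup_k (n @^-1` [set k] `&` F k @^-1` B)).
  apply: bigcupT_measurable => k; apply: measurableI => //.
  by rewrite -[_ @^-1` _]setTI; exact: mF.
by apply/seteqP; split=> [t Bt|t [k _ [/= ->]]//]; exists (n t).
Qed.

Lemma minN_eq (P : nat -> Prop) k : (0 < k)%N ->
  minN P = k <-> P k /\ forall m, (0 < m < k)%N -> ~ P m.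
Proof.
move=> k0; rewrite /minN; split.
- case: xgetP => [n -> [n0 Pn nmin] <-|_ k0']; last by rewrite -k0' in k0.
  split=> // m /andP[m0 mn] Pm; by have := nmin _ m0 Pm; rewrite leqNgt mn.
- move=> [Pk kmin]; apply: xget_unique => [|n [n0 Pn nmin]].
    split=> // m m0 Pm; rewrite leqNgt; apply/negP => mk.
    by apply: (kmin m) => //; rewrite m0.
  apply/eqP; rewrite eqn_leq nmin// leqNgt; apply/negP => nk.
  by apply: (kmin n) => //; rewrite n0.
Qed.

Lemma minN_eq0 (P : nat -> Prop) :
  minN P = 0%N <-> forall m, (0 < m)%N -> ~ P m.
Proof.
split=> [P0 m m0 Pm|nP]; last first.
  by rewrite /minN; case: xgetP => // n _ [n0 Pn _]; case: (nP n).
have exP : exists n, (0 < n)%N && `[< P n >].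
  by exists m; rewrite m0; apply/asboolP.
have [n /andP[n0 /asboolP Pn] nmin] := ex_minnP exP.
suff nP : minN P = n by rewrite -nP P0 in n0.
apply/minN_eq => //; split=> // l /andP[l0 ln] Pl.
have /nmin : (0 < l)%N && `[< P l >] by rewrite l0; apply/asboolP.
by rewrite leqNgt ln.
Qed.

Lemma measurable_minN d (T : measurableType d) (P : T -> nat -> Prop) :
  (forall n, measurable [set t | P t n]) ->
  forall k, measurable ((fun t => minN (P t)) @^-1` [set k]).
Proof.
move=> mP k.
have mC n (m : nat) : measurable [set t | (0 < m < n)%N -> ~ P t m].
  case: (boolP (0 < m < n)%N) => _; last first.
    by rewrite (_ : [set _ | _] = setT)//; apply/seteqP; split.
  rewrite (_ : [set _ | _] = ~` [set t | P t m]); first exact: measurableC.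
  by apply/seteqP; split=> t /= Pt; [exact: Pt|].
have mC' (m : nat) : measurable [set t | (0 < m)%N -> ~ P t m].
  rewrite (_ : [set _ | _] = [set t | (0 < m < m.+1)%N -> ~ P t m])//.
  by rewrite ltnSn andbT.
have [->|k0] := posnP k.
  rewrite (_ : _ @^-1` _ = \bigcap_m [set t | (0 < m)%N -> ~ P t m]).
    exact: bigcapT_measurable.
  apply/seteqP; split=> [t /= /minN_eq0 Pt m _|t /= Pt]; first exact: Pt.
  by apply/minN_eq0 => m; exact: Pt.
rewrite (_ : _ @^-1` _ = [set t | P t k] `&`
    \bigcap_m [set t | (0 < m < k)%N -> ~ P t m]).
  by apply: measurableI => //; exact: bigcapT_measurable.
apply/seteqP; split=> [t /= /(minN_eq _ k0)[Pk Pt]|t /= [Pk Pt]].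
  by split=> // m _; exact: Pt.
by apply/(minN_eq _ k0); split=> // m; exact: Pt.
Qed.

End borel_maps.

(** * The weak topology on Radon measures *)

Section radon_topology.
Variable R : realType.
Implicit Types (nu mu : radon R) (f : Cc R).

Lemma radon_eqP nu mu :
  (forall A, measurable A -> nu A = mu A) -> nu = mu.
Proof.
case: nu mu => [m mc mm] [m' mc' mm'] /= mm'E.
have mE : m = m'.
  apply: eq_measure; apply/funext => A.
  by have [/mm'E//|nA] := pselect (measurable A); rewrite mm// mm'.
by subst m'; rewrite (Prop_irrelevance mc mc') (Prop_irrelevance mm mm').
Qed.

Lemma continuous_pairing f :
  continuous (fun nu : radon R => radon_pairing nu f).
Proof.
move=> nu; apply: (@continuous_comp _ _ _ (@radon_pairing R) (@^~ f)).
  exact: initial_continuous.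
have /cvg_sup/(_ f) pp : radon_pairing nu --> radon_pairing nu by exact: cvg_id.
move=> A nA; apply: pp.
by apply: (@initial_continuous (forall _ : Cc R, R) R (@^~ f)).
Qed.

(** The topology of radon R is initial for the pairings, so continuity into
it is tested against one function at a time. *)
Lemma continuous_radon (X : topologicalType) (g : X -> radon R) :
  (forall f, continuous (fun x => radon_pairing (g x) f)) -> continuous g.
Proof.
move=> cg; apply/continuousP => _ [U oU <-].
have cpg : continuous ((@radon_pairing R \o g) : X -> {ptws Cc R -> R}).
  exact: continuous_ptws.
by move/continuousP : cpg => /(_ _ oU).
Qed.

Lemma Cc_measurable f : measurable_fun [set: R] (sval f).
Proof. by case: f => f [cf cK]; exact: continuous_measurable_fun. Qed.

Lemma Cc_integrable nu f : nu.-integrable [set: R] (EFin \o sval f).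
Proof.
have mf := Cc_measurable f.
case: f mf => f [/= cf cK] mf.
set K := closure _ in cK.
have mK : measurable K by exact: compact_measurable.
rewrite (_ : EFin \o f = (EFin \o f) \_ K).
  apply/integrable_restrict => //; rewrite setTI.
  apply: measurable_bounded_integrable => //.
  - exact: radon_compact.
  - exact: measurable_funTS.
  - have /compact_bounded[M [Mr fM]] : compact (f @` K).
      by apply: continuous_compact => //; exact: continuous_subspaceT.
    by exists M; split=> // N MN x Kx; apply: (fM _ MN); exists x.
apply/funext => x; rewrite patchE; case: ifPn => //= /negP xK.
congr EFin; apply: contrapT => fx; apply: xK; rewrite inE.
by apply: subset_closure => /=; apply/eqP.
Qed.

Lemma pairing_image g g' nu (cg : continuous g) (cg' : continuous g')
    (gK : cancel g g') (g'K : cancel g' g) f f' :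
  (forall x, sval f' x = sval f (g x)) ->
  radon_pairing (radon_image nu cg cg' gK g'K) f = radon_pairing nu f'.
Proof.
move=> ff'; rewrite /radon_pairing /Rintegral /=; congr fine.
have mg : measurable_fun [set: R] g by exact: continuous_measurable_fun.
have mf : measurable_fun [set: R] (EFin \o sval f).
  by apply/measurable_EFinP; exact: Cc_measurable.
have ffE : (EFin \o sval f) \o g = EFin \o sval f'.
  by apply/funext => x /=; rewrite ff'.
rewrite (integral_pushforward mg mf) ?preimage_setT ?ffE//.
exact: Cc_integrable.
Qed.

(** Integrating f against the image measure is integrating f \o g against the
original one, and f \o g still has compact support because g has a continuous
inverse. *)
Lemma continuous_radon_image g g' (cg : continuous g) (cg' : continuous g')
    (gK : cancel g g') (g'K : cancel g' g) :
  continuous (fun nu => radon_image nu cg cg' gK g'K).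
Proof.
apply: continuous_radon => f.
have ccf' : continuous (sval f \o g) /\
    compact (closure [set x | (sval f \o g) x != 0]).
  case: f => f [/= cf cK]; split.
    by move=> x; apply: continuous_comp; [exact: cg|exact: cf].
  apply: (@subclosed_compact _ _ (g' @` closure [set x | f x != 0])).
  - exact: closed_closure.
  - by apply: continuous_compact => //; exact: continuous_subspaceT.
  - move=> x xc; exists (g x) => //.
    suff : closure [set x | f (g x) != 0] `<=`
           g @^-1` closure [set x | f x != 0] by apply.
    have cl : closed (g @^-1` closure [set x | f x != 0]).
      by apply: closed_comp; [move=> y _; exact: cg|exact: closed_closure].
    rewrite [X in _ `<=` X]((closure_id _).1 cl); apply: closure_subset => y /= fy.
    exact: (@subset_closure _ [set x | f x != 0]).
pose f' : Cc R := exist _ (sval f \o g) ccf'.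
rewrite (_ : (fun nu => _) = (fun nu => radon_pairing nu f')).
  exact: continuous_pairing.
by apply/funext => nu; exact: pairing_image.
Qed.

Lemma pairing_scale (c : {nonneg R}) nu f :
  radon_pairing (radon_scale c nu) f = c%:num * radon_pairing nu f.
Proof.
rewrite /radon_pairing /Rintegral /=.
have mf : measurable_fun [set: R] (EFin \o sval f).
  by apply/measurable_EFinP; exact: Cc_measurable.
have ifin := Cc_integrable nu f.
rewrite [in LHS]integralE [in RHS]integralE.
rewrite !ge0_integral_mscale//; last 2 first.
- exact: measurable_funeneg.
- exact: measurable_funepos.
have [Fp Fn] := (integral_funepos_lt_pinfty measurableT ifin,
                 integral_funeneg_lt_pinfty measurableT ifin).
have p0 := @integral_ge0 _ _ _ nu setT _ (fun x _ => funepos_ge0 (EFin \o sval f) x).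
have n0 := @integral_ge0 _ _ _ nu setT _ (fun x _ => funeneg_ge0 (EFin \o sval f) x).
rewrite -muleBr// ?fineM//.
- by rewrite fin_numB !ge0_fin_numE// Fp.
- by apply: fin_num_adde_defr; rewrite ge0_fin_numE.
Qed.
End radon_topology.

(** * Measurability of evaluation and of scaling *)

Section radon_measurability.
Variable R : realType.
Implicit Types (nu mu : radon R) (f : Cc R).

Lemma continuous_borel_real (X : ptopologicalType) (g : X -> R) :
  continuous g -> measurable_fun [set: borel X] (g : borel X -> R).
Proof.
move=> /continuousP cg.
apply: (measurability _ (RGenOpens.measurableE R)).
move=> _ [_ [a [b ->]] <-]; rewrite setTI.
by apply: measurable_open; apply: cg; exact: interval_open.
Qed.

(** Continuous functions of compact support converging to the indicator of [a, b[:
the left ramp sits outside the interval and the right ramp inside,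
which is what makes the limit the half-open interval. *)
Definition trapeze (a b : R) (n : nat) (x : R) : R :=
  Num.max 0 (Num.min 1 (Num.min (n.+1%:R * (x - a) + 1) (n.+1%:R * (b - x)))).

Lemma trapeze_Cc a b n : continuous (trapeze a b n) /\
  compact (closure [set x | trapeze a b n x != 0]).
Proof.
split.
  have c1 : continuous (fun x : R => n.+1%:R * (x - a) + 1).
    move=> x; apply: cvgD; last exact: cvg_cst.
    by apply: cvgM; [exact: cvg_cst|apply: cvgB; [exact: cvg_id|exact: cvg_cst]].
  have c2 : continuous (fun x : R => n.+1%:R * (b - x)).
    move=> x; apply: cvgM; first exact: cvg_cst.
    by apply: cvgB; [exact: cvg_cst|exact: cvg_id].
  move=> x.
  apply: (@continuous_max R R (cst 0) (cst 1 \min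
    ((fun x => n.+1%:R * (x - a) + 1) \min (fun x => n.+1%:R * (b - x))))).
    exact: cvg_cst.
  apply: (@continuous_min R R); first exact: cvg_cst.
  by apply: (@continuous_min R R); [exact: c1|exact: c2].
apply: (@subclosed_compact _ _ `[a - 1, b]).
- exact: closed_closure.
- exact: segment_compact.
- rewrite [X in _ `<=` X]((closure_id _).1 (@itv_closed _ R (a - 1) b)).
  apply: closure_subset => x /=; rewrite /trapeze in_itv/= => h.
  have n0 : (0 : R) < n.+1%:R by [].
  have n1 : (1 : R) <= n.+1%:R by rewrite ler1n.
  apply/andP; split; rewrite leNgt; apply/negP => hx; move/eqP: h; apply;
    apply/max_idPl; rewrite !ge_min; apply/orP; right; apply/orP.
    left; nra.
  by right; rewrite pmulr_rle0// subr_le0 ltW.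
Qed.

Lemma trapeze_cvg a b x :
  (trapeze a b n x)%:E @[n --> \oo] --> (\1_(`[a, b[%classic) x)%:E.
Proof.
have far (e : R) : 0 < e -> \forall n \near \oo, 1 <= n.+1%:R * e.
  move=> e0; near=> n; rewrite -ler_pdivrMr// mul1r.
  apply: (@le_trans _ _ n%:R); last by rewrite ler_nat.
  by near: n; exact: nbhs_infty_ger.
apply: cvg_near_cst.
rewrite indicE; case: (boolP (x \in _)) => [|/negP]; rewrite inE/= in_itv/=.
- move=> /andP[ax xb]; near=> n; congr EFin.
  rewrite /trapeze (min_idPl _); first by rewrite (max_idPr _)// ler01.
  rewrite le_min; apply/andP; split.
    by rewrite lerDr mulr_ge0// subr_ge0.
  by near: n; apply: far; rewrite subr_gt0.
- move=> /negP; rewrite negb_and -!ltNge -leNgt => /orP[xa|bx].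
    near=> n; congr EFin; rewrite /trapeze; apply/max_idPl.
    rewrite !ge_min; apply/orP; right; apply/orP; left.
    have : 1 <= n.+1%:R * (a - x) by near: n; apply: far; rewrite subr_gt0.
    by rewrite -opprB mulrN; lra.
  near=> n; congr EFin; rewrite /trapeze; apply/max_idPl.
  rewrite !ge_min; apply/orP; right; apply/orP; right.
  by rewrite pmulr_rle0// subr_le0.
Unshelve. all: by end_near. Qed.

Lemma trapeze_itv01 a b n x : 0 <= trapeze a b n x <= 1.
Proof. by rewrite /trapeze le_max lexx/= ge_max ler01 ge_min lexx. Qed.

Lemma trapeze_le a b n x : trapeze a b n x <= \1_(`[a - 1, b]%classic) x.
Proof.
rewrite indicE; case: (boolP (x \in _)) => [_|/negP]; rewrite ?inE/= ?in_itv/=.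
  by have /andP[] := trapeze_itv01 a b n x.
have n1 : (1 : R) <= n.+1%:R by rewrite ler1n.
move=> /negP; rewrite negb_and -!ltNge => /orP[xa|bx];
  rewrite /trapeze ge_max lexx/= !ge_min; apply/orP; right; apply/orP.
  by left; nra.
by right; rewrite pmulr_rle0// subr_le0 ltW.
Qed.

Lemma radon_itv_fin nu a b : (nu `[a, b[%classic < +oo)%E.
Proof.
apply: le_lt_trans (radon_compact nu (@segment_compact R a b)).
apply: le_measure; rewrite ?inE//.
by apply: subset_itvl; rewrite bnd_simp.
Qed.

(** The mass of [a, b[ is the limit of the integrals of the trapezes, by
dominated convergence, and each of these depends continuously on nu. *)
Lemma measurable_eval a b :
  measurable_fun [set: borel (radon R)]
    (fun nu : borel (radon R) => (nu : radon R) `[a, b[%classic).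
Proof.
pose F n : Cc R := exist _ (trapeze a b n) (trapeze_Cc a b n).
apply: (@emeasurable_fun_cvg _ _ _ _
  (fun n (nu : borel (radon R)) => (radon_pairing nu (F n))%:E)).
  move=> n; apply/measurable_EFinP.
  by apply: continuous_borel_real; exact: continuous_pairing.
move=> nu _.
rewrite (_ : (fun n => _) =
    (fun n => \int[nu : radon R]_x (trapeze a b n x)%:E)%E); last first.
  apply/funext => n; rewrite fineK//.
  by apply: integrable_fin_num => //; exact: (Cc_integrable _ (F n)).
rewrite -[`[a, b[%classic in X in _ --> X]setIT -integral_indic//.
apply: (@dominated_cvg _ _ _ _ _ _ _ _ (EFin \o \1_(`[a - 1, b]%classic))) => //.
- by move=> n; apply/measurable_EFinP; exact: (Cc_measurable (F n)).
- by move=> x _; exact: trapeze_cvg.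
- apply/integrableP; split; first by apply/measurable_EFinP.
  under eq_integral do rewrite gee0_abs ?lee_fin//.
  by rewrite integral_indic// setIT; by apply: radon_compact; exact: segment_compact.
- move=> n x _ /=; rewrite lee_fin ger0_norm; first exact: trapeze_le.
  by have /andP[] := trapeze_itv01 a b n x.
Qed.

(** Scaling is jointly continuous in the factor and in the measure; the map
t |-> (F t, c t) is measurable because the line is second countable. *)
Lemma measurable_radon_scale d (T : measurableType d) (c : T -> {nonneg R})
    (F : T -> borel (radon R)) :
  measurable_fun [set: T] (fun t => (c t)%:num) -> measurable_fun [set: T] F ->
  measurable_fun [set: T] ((fun t => radon_scale (c t) (F t)) : T -> borel (radon R)).
Proof.
move=> mc mF.
(* The absolute value only serves to make the factor nonnegative on the whole line. *)
pose S (x : radon R * R) : radon R := radon_scale (NngNum (normr_ge0 x.2)) x.1.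
have cS : continuous S.
  apply: continuous_radon => f.
  rewrite (_ : (fun x => _) = (fun x => `|x.2| * radon_pairing x.1 f)); last first.
    by apply/funext => x; rewrite pairing_scale.
  move=> x; apply: cvgM.
    by apply: (@cvg_norm _ R^o); exact: cvg_snd.
  apply: (@continuous_comp _ _ _ fst (fun nu : radon R => radon_pairing nu f)).
    exact: cvg_fst.
  exact: continuous_pairing.
have mS := continuous_borel cS.
have : measurable_fun [set: T]
    ((fun t => (F t, (c t)%:num)) : T -> borel (radon R * R)%type).
  refine (@measurable_fun_pair_borel _ T (radon R) R _
    (fun ab : rat * rat => `]ratr ab.1, ratr ab.2[%classic) F (fun t => (c t)%:num) _ _ _ _) => //.
  - by move=> U y oU Uy; exact: open_rat_itv.
  - by move=> i; rewrite -[_ @^-1` _]setTI; apply: mc.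
move/(measurableT_comp mS); apply: eq_measurable_fun => t _ /=.
rewrite /S/=; congr radon_scale; apply/val_inj => /=.
by rewrite ger0_norm.
Qed.
End radon_measurability.

(** * Normalization *)

Section normalization.
Variable R : realType.
Implicit Types (nu mu : radon R).

Lemma window1 : @window R 1 = `[0, 1[%classic.
Proof. by rewrite /window subrr oppr0. Qed.

Lemma measurable_psi k : measurable ((@psi R : borel (radon R) -> nat) @^-1` [set k]).
Proof.
apply: measurable_minN => n.
have := @measurable_eval R (- (n%:R - 1)) n%:R measurableT (`]0%:E, +oo%E]%classic : set (\bar R)).
by rewrite setTI => /(_ (emeasurable_itv _)); congr measurable;
  apply/seteqP; split=> nu /=; rewrite in_itv/= leey andbT.
Qed.

(** The factor depends on the measure only in a Borel way (through psi), so
continuity of the normalization fails, and it is treated as a scaling by a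
measurable factor. *)
Lemma measurable_normalize :
  measurable_fun [set: borel (radon R)]
    (@normalize R : borel (radon R) -> borel (radon R)).
Proof.
apply: measurable_radon_scale => //=.
have mw : measurable_fun [set: borel (radon R)]
    (@window_mass R : borel (radon R) -> R).
  apply: (@measurable_fun_piecewise _ _ (borel (radon R)) R (@psi R)
    (fun k (nu : borel (radon R)) => fine ((nu : radon R) (@window R k)))).
    exact: measurable_psi.
  move=> k; apply: (measurableT_comp (@fine_measurable R _ measurableT)) => //.
  exact: measurable_eval.
(* The power -1 agrees with the inverse on nonnegative numbers, also at 0. *)
rewrite (_ : (fun nu => _) =
    (fun nu : borel (radon R) => window_mass (nu : radon R) `^ (-1))).
  exact: (measurableT_comp (measurable_powR _)).
by apply/funext => nu; rewrite powR_inv1// fine_ge0.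
Qed.

Lemma psi_gt0P nu : (0 < psi nu)%N -> (0 < nu (window (psi nu)))%E.
Proof. by move=> p0; have [] := (minN_eq _ p0).1 (erefl (psi nu)). Qed.

Lemma radon_itv_num nu a b : nu `[a, b[%classic \is a fin_num.
Proof. by rewrite ge0_fin_numE ?radon_itv_fin. Qed.

Lemma normalizeE nu A :
  normalize nu A = (((window_mass nu)^-1)%:E * nu A)%E.
Proof. by []. Qed.

(** The windows exhaust the line. *)
Lemma psi_eq0_null nu : psi nu = 0%N -> forall A, measurable A -> nu A = 0%E.
Proof.
move=> /minN_eq0 p0.
have nw n : nu (@window R n.+1) = 0%E.
  apply/eqP; rewrite eq_le measure_ge0 andbT leNgt; apply/negP.
  exact: p0.
have mw n : measurable (@window R n.+1) by exact: measurable_itv.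
have nT : nu (\bigcup_n @window R n.+1) = 0%E.
  apply: (negligibleP nu (bigcupT_measurable _ mw)).1.
  by apply: negligible_bigcup => n; exact: (negligibleP nu (mw n)).2 (nw n).
move=> A mA; apply/eqP; rewrite eq_le measure_ge0 andbT -nT.
apply: le_measure; rewrite ?inE//; first exact: bigcupT_measurable.
move=> x _; have [n xn] : exists n : nat, `|x| < n%:R.
  by exists (Num.trunc `|x|).+1; rewrite truncnS_gt.
exists n => //; rewrite /window/= in_itv/=.
move: xn; rewrite ltr_norml => /andP[nx xn].
by rewrite -natr1 addrK (ltW nx)/= ltr_wpDr.
Qed.

(** For the zero measure any factor will do, which is why a positive one always
exists. *)
Lemma normalize_scale nu : exists2 c : R, 0 < c &
  forall A, measurable A -> normalize nu A = (c%:E * nu A)%E.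
Proof.
have [p0|p0] := posnP (psi nu).
  exists 1 => // A mA; rewrite normalizeE.
  by rewrite (psi_eq0_null p0)// !mule0.
exists (window_mass nu)^-1 => //.
rewrite invr_gt0 fine_gt0// psi_gt0P//=.
exact: radon_itv_fin.
Qed.

Lemma normalize_gt0 nu A : measurable A ->
  (0 < normalize nu A)%E = (0 < nu A)%E.
Proof.
move=> mA; have [c c0 ->//] := normalize_scale nu.
by rewrite pmule_rgt0.
Qed.

(** Multiplying a measure by c > 0 does not change psi and multiplies the mass
of the first charged window by c. *)
Lemma normalize_scaled nu mu (c : R) : 0 < c ->
  (forall A, measurable A -> mu A = (c%:E * nu A)%E) ->
  normalize mu = normalize nu.
Proof.
move=> c0 munu.
have mw n : measurable (@window R n) by exact: measurable_itv.
have psiE : psi mu = psi nu.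
  rewrite /psi; congr minN; apply/funext => n.
  by rewrite munu// pmule_rgt0.
have wE : window_mass mu = c * window_mass nu.
  by rewrite /window_mass psiE munu// fineM//; exact: radon_itv_num.
apply: radon_eqP => A mA; rewrite !normalizeE wE munu// muleA -EFinM.
by rewrite invfM mulrAC mulVf ?gt_eqF// mul1r.
Qed.

Lemma normalizeK nu : normalize (normalize nu) = normalize nu.
Proof. by have [c c0 nE] := normalize_scale nu; exact: normalize_scaled nE. Qed.

(** Consequently a chain of images and normalizations may be normalized once, at
the end. *)
Lemma normalize_image g g' nu (cg : continuous g) (cg' : continuous g')
    (gK : cancel g g') (g'K : cancel g' g) :
  normalize (radon_image (normalize nu) cg cg' gK g'K) =
  normalize (radon_image nu cg cg' gK g'K).
Proof.
have [c c0 nE] := normalize_scale nu.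
apply: (normalize_scaled c0) => A mA; apply: nE.
by rewrite -[_ @^-1` _]setTI; exact: continuous_measurable_fun.
Qed.

Lemma window_mass_unit nu : (0 < nu (@unit_itv R))%E ->
  window_mass nu = fine (nu (@unit_itv R)).
Proof.
move=> nu0; suff p1 : psi nu = 1%N by rewrite /window_mass p1 window1.
apply/minN_eq => //; split; first by rewrite window1.
by move=> [|[]].
Qed.

(** When [0, 1) is charged it is the first charged window, so it is its mass that
is divided out. *)
Lemma normalize_unit nu A : (0 < nu (@unit_itv R))%E ->
  (normalize nu A * nu (@unit_itv R))%E = nu A.
Proof.
move=> nu0; rewrite normalizeE window_mass_unit//.
have nf := radon_itv_num nu 0 1.
rewrite muleAC -[X in (_ * X * _)%E]fineK// -EFinM mulVf ?mul1e//.
by rewrite gt_eqF// fine_gt0// nu0 -ge0_fin_numE.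
Qed.

Lemma normalize_unit01 nu : normalize nu (@unit_itv R) = 0%E \/
  normalize nu (@unit_itv R) = 1%E.
Proof.
have := measure_ge0 nu (@unit_itv R); rewrite le_eqVlt => /predU1P[nu0|nu0].
  by left; rewrite normalizeE -nu0 mule0.
right; rewrite normalizeE window_mass_unit//.
have nf := radon_itv_num nu 0 1.
rewrite -[X in (_ * X)%E]fineK// -EFinM mulVf//.
by rewrite gt_eqF// fine_gt0// nu0 -ge0_fin_numE.
Qed.

End normalization.

(** * Adding an integer to a digit sequence *)

Section digits.
Variable q : nat.
Local Notation p := q.+2.
Implicit Types (i s : one_sided q) (j : digit q) (k : int).

Definition dnat (j : digit q) : nat := nat_of_ord (j : 'I_p).

Lemma dnat_inj : injective dnat.
Proof. exact: ord_inj. Qed.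

Lemma dnat_lt j : (dnat j < p)%N.
Proof. exact: ltn_ord. Qed.

(** The integer written in base p by the last m digits, i_0 being the unit
digit: the left end of I_{-m} is minus this number. *)
Definition pval m i : nat := (\sum_(l < m) dnat (i l) * p ^ l)%N.

(** Adjoining a digit at time 0 and moving the earlier ones one step back. *)
Definition dcons j i : one_sided q := fun l => if l is l'.+1 then i l' else j.

Lemma pvalS m i : pval m.+1 i = (pval m i + dnat (i m) * p ^ m)%N.
Proof. by rewrite /pval big_ord_recr. Qed.

Lemma pval_cons m j i : pval m.+1 (dcons j i) = (dnat j + p * pval m i)%N.
Proof.
rewrite /pval big_ord_recl /= muln1; congr (_ + _)%N.
by rewrite big_distrr; apply: eq_bigr => l _ /=; rewrite expnS mulnCA.
Qed.

Lemma dcons_eta i : i = dcons (i 0%N) (fun l => i l.+1).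
Proof. by apply/funext => -[]. Qed.

Lemma pval_lt m i : (pval m i < p ^ m)%N.
Proof.
elim: m => [|m IH]; first by rewrite /pval big_ord0.
rewrite pvalS expnS; have := dnat_lt (i m).
by move: (p ^ m)%N (dnat _) IH => P d; nia.
Qed.

Lemma pval_inj m i s : pval m i = pval m s -> forall l, (l < m)%N -> i l = s l.
Proof.
elim: m i s => // m IH i s.
rewrite [in X in X -> _](dcons_eta i) [in X in X -> _](dcons_eta s) !pval_cons.
have := dnat_lt (i 0%N); have := dnat_lt (s 0%N) => s0 i0 E.
have E0 : dnat (i 0%N) = dnat (s 0%N).
  have := congr1 (fun n => n %% p)%N E.
  by rewrite ![(_ + p * _)%N]addnC ![(p * _)%N]mulnC !modnMDl !modn_small.
have E1 : pval m (fun l => i l.+1) = pval m (fun l => s l.+1) by nia.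
by case=> [|l] lm; [exact: dnat_inj|exact: (IH _ _ E1 l)].
Qed.

Lemma eq_pval m i s : (forall l, (l < m)%N -> i l = s l) -> pval m i = pval m s.
Proof. by move=> E; apply: eq_bigr => l _; rewrite E. Qed.

(** s is obtained by adding k to the number written by the last m digits of i,
the addition producing no carry into the digit m. This is the arithmetic content
of is_s. *)
Definition shifts m k i s := (pval m s)%:Z = (pval m i)%:Z + k /\
  forall l, (m <= l)%N -> s l = i l.

Lemma shiftsW m n k i s : (m <= n)%N -> shifts m k i s -> shifts n k i s.
Proof.
move=> mn [sk st]; split; last by move=> l nl; apply: st; exact: leq_trans nl.
elim: n mn => [|n IH]; first by rewrite leqn0 => /eqP <-.
rewrite leq_eqVlt => /predU1P[<-//|mn].
by rewrite !pvalS !PoszD (IH mn) (st _ mn) addrAC.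
Qed.

Lemma shifts_uniq m n k i s s' : shifts m k i s -> shifts n k i s' -> s = s'.
Proof.
move=> /(shiftsW (leq_maxl m n)) [sk st] /(shiftsW (leq_maxr m n)) [sk' st'].
apply/funext => l; have [lm|ml] := ltnP l (maxn m n).
  by apply: (pval_inj (m := maxn m n)) => //; lia.
by rewrite st// st'.
Qed.

Lemma shiftsN m k i s : shifts m k i s -> shifts m (- k) s i.
Proof. by move=> [sk st]; split; [lia|move=> l ml; rewrite st]. Qed.

(** Schoolbook addition: j' is the new unit digit and k' the carry, to be added
to the remaining digits. *)
Lemma shifts_cons m k k' j j' i s : (dnat j)%:Z + k = (dnat j')%:Z + p%:Z * k' ->
  shifts m k' i s -> shifts m.+1 k (dcons j i) (dcons j' s).
Proof.
move=> jk [sk st]; split; last by case=> // l ml; exact: st.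
rewrite !pval_cons; nia.
Qed.

(** The addition of k can be carried out within the last m digits; equivalently
[k, k + 1) is contained in I_{-m}. *)
Definition fits m k i := 0 <= (pval m i)%:Z + k < (p ^ m)%:Z.

Lemma fitsW m n k i : (m <= n)%N -> fits m k i -> fits n k i.
Proof.
elim: n => [|n IH]; first by rewrite leqn0 => /eqP <-.
rewrite leq_eqVlt => /predU1P[<-//|mn] /(IH mn).
rewrite /fits pvalS expnS; have := dnat_lt (i n).
by move: (p ^ n)%N (dnat _) (pval _ _) => P d v; nia.
Qed.

Lemma shifts_fits m k i s : shifts m k i s -> fits m k i.
Proof. by move=> [sk _]; rewrite /fits -sk; have := pval_lt m s; lia. Qed.

Definition add_digits m k i : one_sided q := fun l =>
  if (l < m)%N then inord ((absz ((pval m i)%:Z + k)%R %/ p ^ l) %% p)%N : 'I_p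
  else i l.

Lemma pval_digits m n i : (n < p ^ m)%N ->
  (forall l, (l < m)%N -> dnat (i l) = (n %/ p ^ l) %% p)%N -> pval m i = n.
Proof.
elim: m n i => [|m IH] n i; first by rewrite /pval big_ord0; case: n.
move=> nm il; rewrite (dcons_eta i) pval_cons (IH (n %/ p)%N).
- by rewrite il// divn1 addnC mulnC -divn_eq.
- by rewrite ltn_divLR// mulnC -expnS.
- by move=> l lm; rewrite il// expnS divnMA.
Qed.

Lemma add_digitsP m k i : fits m k i -> shifts m k i (add_digits m k i).
Proof.
move=> /andP[k0 km]; split; last by move=> l; rewrite /add_digits ltnNge => ->.
rewrite (@pval_digits _ (absz ((pval m i)%:Z + k)%R)); first by lia.
  by lia.
by move=> l lm; rewrite /add_digits lm /dnat inordK// ltn_mod.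
Qed.

Lemma fits_cons m k k' j j' i : (dnat j)%:Z + k = (dnat j')%:Z + p%:Z * k' ->
  fits m.+1 k (dcons j i) = fits m k' i.
Proof.
move=> jk; rewrite /fits pval_cons expnS.
have := dnat_lt j'; move: jk; move: (p ^ m)%N (dnat j) (dnat j') (pval _ _) => P d d' v jk d'p.
apply/idP/idP; nia.
Qed.

Definition unsettled i := forall j, ~ exists m, forall l, (m <= l)%N -> i l = j.

Lemma pval_unbounded i N : ~ (exists m, forall l, (m <= l)%N -> i l = ord0 :> 'I_p) ->
  exists m, (N <= pval m i)%N.
Proof.
move=> i0; elim: N => [|N [m Nm]]; first by exists 0%N.
have [l ml il] : exists2 l, (m <= l)%N & i l <> ord0 :> 'I_p.
  apply: contrapT => nl; apply: i0; exists m => l ml.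
  by apply: contrapT => il; apply: nl; exists l.
exists l.+1; rewrite pvalS.
have ml' : (pval m i <= pval l i)%N.
  elim: l ml {il} => [|l IH]; first by rewrite leqn0 => /eqP ->.
  rewrite leq_eqVlt => /predU1P[->//|ml]; rewrite pvalS.
  by apply: leq_trans (IH ml) _; rewrite leq_addr.
have : (0 < dnat (i l))%N.
  by rewrite lt0n; apply/eqP => il0; apply: il; exact/ord_inj.
have := expn_gt0 p l; rewrite /= => P0 d0.
have : (0 < dnat (i l) * p ^ l)%N by rewrite muln_gt0 d0.
lia.
Qed.

Lemma pval_rev m i :
  (pval m i + pval m (fun l => rev_ord (i l : 'I_p) : 'I_p) = (p ^ m).-1)%N.
Proof.
elim: m => [|m IH]; first by rewrite /pval !big_ord0.
rewrite !pvalS expnS.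
have -> : dnat (rev_ord (i m : 'I_p) : 'I_p) = (p - (dnat (i m)).+1)%N by [].
have := dnat_lt (i m); have : (0 < p ^ m)%N by rewrite expn_gt0.
by move: (p ^ m)%N (dnat _) (pval _ _) (pval _ _) IH => P d v v'; nia.
Qed.

(** If the digits are not eventually 0, the number they write is unbounded, which
is what a negative k needs; for a positive k apply this to the complementary
digits p - 1 - i_l, which are not eventually 0 either. *)
Lemma unsettled_fits k i : unsettled i -> exists m, fits m k i.
Proof.
move=> iu.
have [|m1 h1] := @pval_unbounded i `|k|%N; first exact: iu.
have [|m2 h2] := @pval_unbounded (fun l => rev_ord (i l : 'I_p) : 'I_p) `|k|%N.
  move=> [m im]; apply: (iu (rev_ord ord0 : 'I_p)); exists m => l ml.
  by rewrite -(im l ml) rev_ordK.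
have := pval_rev m2 i; have : (0 < p ^ m2)%N by rewrite expn_gt0.
have := pval_lt m1 i.
have [k0|k0] := leP 0 k; [exists m2|exists m1]; rewrite /fits; lia.
Qed.

Lemma unsettled_shifts m k i s : shifts m k i s -> unsettled i -> unsettled s.
Proof.
move=> [_ st] iu j [n nj]; apply: (iu j); exists (maxn m n) => l.
by rewrite geq_max => /andP[ml nl]; rewrite -st// nj.
Qed.

End digits.

(** * Well based sequences *)

Section well_based_sequences.
Variables (R : realType) (q : nat).
Local Notation p := q.+2.
Implicit Types (i s : one_sided q) (j : digit q) (k : int).

Lemma digit_valE j : digit_val R j = (dnat j)%:R. Proof. by []. Qed.

Lemma subitv_inj j (I J : R * R) : Defs.subitv I j = Defs.subitv J j -> I = J.
Proof.
case: I J => [a b] [a' b']; rewrite /Defs.subitv/= => -[e1 e2].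
have p0 : (p%:R : R) != 0 by rewrite pnatr_eq0.
(* The length of the subinterval is 1 / p times that of the interval. *)
have L : b - a = b' - a'.
  have : (b - a) / p%:R = (b' - a') / p%:R.
    rewrite -[LHS](addrK (a + digit_val R j * (b - a) / p%:R)).
    rewrite -[RHS](addrK (a' + digit_val R j * (b' - a') / p%:R)) -{2}e1.
    congr (_ - _); transitivity (a + (digit_val R j + 1) * (b - a) / p%:R).
      by field.
    by rewrite e2; field.
  by move/divIf; exact.
have aa : a = a'.
  by move: e1; rewrite L => /addIr.
by move: L; rewrite aa => /addIr ->.
Qed.

(** The interval I_{-m} of the well based sequence. *)
Definition base_itv i m : R * R :=
  (- (pval m i)%:R, - (pval m i)%:R + (p ^ m)%:R).

Lemma base_itv_well_based i : well_based i (base_itv i).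
Proof.
have p0 : (p%:R : R) != 0 by rewrite pnatr_eq0.
split; first by rewrite /base_itv /pval big_ord0 oppr0 add0r.
move=> m; rewrite /base_itv /Defs.subitv/= pvalS digit_valE expnS natrM natrD natrM.
by move: (p%:R : R) p0 => x x0; congr (_, _); field.
Qed.

Lemma well_based_uniq i I : well_based i I -> forall m, I m = base_itv i m.
Proof.
have [b0 bS] := base_itv_well_based i.
move=> [I0 IS]; elim=> [|m IH]; first by rewrite I0 b0.
by apply: (@subitv_inj (i m)); rewrite IS bS.
Qed.

Lemma foldl_subitv s m (a b : R) :
  foldl (@Defs.subitv R q) (a, b) (rev (mkseq s m)) =
  (a + (pval m s)%:R / (p ^ m)%:R * (b - a),
   a + ((pval m s)%:R + 1) / (p ^ m)%:R * (b - a)).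
Proof.
have p0 : (p%:R : R) != 0 by rewrite pnatr_eq0.
elim: m a b => [|m IH] a b.
  by rewrite /= /pval big_ord0 expn0; congr (_, _); field.
have P0 : ((p ^ m)%:R : R) != 0 by rewrite pnatr_eq0 expn_eq0.
rewrite /mkseq -addn1 iotaD map_cat /= rev_cat/= add0n.
rewrite /Defs.subitv/= IH addn1 pvalS expnS digit_valE !natrM natrD natrM.
move: (p%:R : R) ((p ^ m)%:R : R) p0 P0 => x y x0 y0.
by congr (_, _); field; rewrite x0 y0.
Qed.

(** All intervals of the well based sequence are explicit, and descending from
I_{-m} along the digits of s ends at the unit interval whose left end is
pval m s - pval m i. *)
Lemma is_sP k i s : is_s R k i s <-> exists m, shifts m k i s.
Proof.
have fE m : foldl (@Defs.subitv R q) (base_itv i m) (rev (mkseq s m)) =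
    (- (pval m i)%:R + (pval m s)%:R, - (pval m i)%:R + (pval m s)%:R + 1).
  have P0 : ((p ^ m)%:R : R) != 0 by rewrite pnatr_eq0 expn_eq0.
  by rewrite foldl_subitv; congr (_, _); field.
split=> [[I [m [wI _ fI sI]]]|[m [sk st]]].
  exists m; split=> //; move: fI; rewrite (well_based_uniq wI) fE => -[+ _].
  move=> /(canRL (addKr _)); rewrite opprK => E.
  by apply/eqP; rewrite -(eqr_int R) intrD -!pmulrn -E.
exists (base_itv i), m; split=> //.
- exact: base_itv_well_based.
- move=> x; rewrite /itv_of /= !in_itv /= => /andP[kx xk].
  have [k0 k1] : 0 <= (pval m i)%:R + k%:~R :> R /\
                 (pval m i)%:R + k%:~R + 1 <= (p ^ m)%:R :> R.
    have -> : (pval m i)%:R + k%:~R = (pval m s)%:R :> R.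
      by rewrite [RHS]pmulrn sk intrD -pmulrn.
    by rewrite ler0n natr1 ler_nat pval_lt.
  by apply/andP; split; lra.
- rewrite fE; have -> : (pval m s)%:R = (pval m i)%:R + k%:~R :> R.
    by rewrite [LHS]pmulrn sk intrD -pmulrn.
  by rewrite addKr.
Qed.

Lemma s_shifts m k i s : shifts m k i s -> s_ R k i = s.
Proof.
move=> h; rewrite /s_; apply: xget_unique; first by apply/is_sP; exists m.
by move=> s' /is_sP[n h']; exact: shifts_uniq h' h.
Qed.

Lemma s_fits m k i : fits m k i -> s_ R k i = add_digits m k i.
Proof. by move/add_digitsP/s_shifts. Qed.

Lemma s_nofits k i : (forall m, ~ fits m k i) -> s_ R k i = i.
Proof.
move=> nf; rewrite /s_ xgetPN// => s /is_sP[m /shifts_fits].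
exact: nf.
Qed.

Lemma s_K m k i : fits m k i -> s_ R (- k) (s_ R k i) = i.
Proof.
by move=> /add_digitsP h; rewrite (s_shifts h) (s_shifts (shiftsN h)).
Qed.

Lemma s_0 i : s_ R 0 i = i.
Proof. by apply: (@s_shifts 0); split=> //; rewrite addr0. Qed.

Lemma s_unsettled k i : unsettled i -> unsettled (s_ R k i).
Proof.
move=> iu; have [m fm] := @unsettled_fits _ k i iu; have h := add_digitsP fm.
by rewrite (s_shifts h); exact: unsettled_shifts h iu.
Qed.

Lemma s_cons m k k' j j' i : (dnat j)%:Z + k = (dnat j')%:Z + p%:Z * k' ->
  fits m k' i -> s_ R k (dcons j i) = dcons j' (s_ R k' i).
Proof.
move=> jk /add_digitsP h; rewrite (s_shifts h).
exact: s_shifts (shifts_cons jk h).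
Qed.

End well_based_sequences.

(** * Measurability of T, of its inverse and of phi *)

Section omega_minus_measurability.
Variables (R : realType) (q : nat).
Local Notation p := q.+2.
Local Notation Om := (omega_minus R q).
Implicit Types (i s : one_sided q) (j : digit q) (k : int) (x : Om).

Definition cylinder (l : seq 'I_p) : set (one_sided q) :=
  [set i | forall n, (n < size l)%N -> i n = nth ord0 l n].

Lemma open_digit n j : open [set i : one_sided q | i n = j].
Proof.
have cn : continuous ((fun i => i n) : one_sided q -> digit q).
  by move=> i; exact: (@proj_continuous nat (fun=> digit q) n i).
by move/continuousP : cn => /(_ [set j]); apply; exact: discrete_open.
Qed.

Lemma open_cylinder l : open (cylinder l).
Proof.
rewrite (_ : cylinder l =
    \bigcap_(n in `I_(size l)) [set i : one_sided q | i n = nth ord0 l n])//.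
rewrite bigcap_mkord; elim/big_ind : _ => //; [exact: openT|exact: openI|].
by move=> n _; exact: open_digit.
Qed.

(** The cylinders around i form a filter which converges to i in every
coordinate, hence in the product topology, so it contains every neighbourhood
of i. *)
Lemma cylinder_base (U : set (one_sided q)) i : open U -> U i ->
  exists l, cylinder l i /\ cylinder l `<=` U.
Proof.
move=> oU Ui.
pose F := filter_from [set: nat] (fun n => [set s : one_sided q |
  forall m, (m < n)%N -> s m = i m]).
have FF : Filter F.
  apply: filter_from_filter; first by exists 0%N.
  move=> m n _ _; exists (maxn m n) => // s h; split=> l lm; apply: h.
    by rewrite leq_max lm.
  by rewrite leq_max lm orbT.
have Fi : F --> (i : {ptws nat -> digit q}).
  apply/cvg_sup => n A [_ [[B oB <-] Bi BA]].
  by exists n.+1 => // s h; apply: BA => /=; rewrite h.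
have [n _ nU] : F U by apply: Fi; exact: open_nbhs_nbhs.
exists (mkseq (fun m => i m : 'I_p) n); split=> [m|s /= h].
  by rewrite size_mkseq => mn; rewrite nth_mkseq.
apply: nU => m mn; rewrite h ?size_mkseq//.
by rewrite nth_mkseq.
Qed.

Lemma measurable_to_mstar d (T : measurableType d) (f : T -> borel (radon R)) :
  measurable_fun [set: T] f ->
  measurable_fun [set: T] ((fun t => to_mstar (f t : radon R)) : T -> borel (mstar R)).
Proof.
move=> mf; apply: measurable_fun_borel => _ [V oV <-].
have := (measurableT_comp (@measurable_normalize R) mf) measurableT V.
by rewrite setTI; apply; exact: measurable_open.
Qed.

Lemma measurable_fun_omega_minus d (T : measurableType d)
    (f : T -> borel (mstar R)) (g : T -> one_sided q) :
  measurable_fun [set: T] f ->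
  (forall n j, measurable [set t | g t n = j]) ->
  measurable_fun [set: T] ((fun t => (f t, g t)) : T -> Om).
Proof.
move=> mf mg.
apply: (@measurable_fun_pair_borel _ T (mstar R) (one_sided q) _ cylinder) => //.
- by move=> l; exact: open_cylinder.
- by move=> U y; exact: cylinder_base.
- move=> l; rewrite (_ : _ @^-1` _ =
    \bigcap_(n in `I_(size l)) [set t | g t n = nth ord0 l n])//.
  by apply: fin_bigcap_measurable => // n _; exact: mg.
Qed.

Lemma measurable_digit n j : measurable [set x : Om | x.2 n = j].
Proof.
apply: measurable_open.
have c2 : continuous (snd : (mstar R * one_sided q)%type -> one_sided q).
  by move=> x; exact: cvg_snd.
move/continuousP : c2 => /(_ _ (open_digit n j)); exact.
Qed.

(** Only countably many words of length m have to be tested. *)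
Lemma measurable_digits (P : one_sided q -> Prop) m :
  (forall i s, (forall l, (l < m)%N -> i l = s l) -> P i -> P s) ->
  measurable [set x : Om | P x.2].
Proof.
move=> Pm.
(* The digits beyond the word are 0 by default: P sees only the first m digits. *)
pose ext (l : seq 'I_p) : one_sided q := fun n => nth ord0 l n.
rewrite (_ : [set _ | _] = \bigcup_(l : seq 'I_p)
    ([set _ | size l = m /\ P (ext l)] `&`
     \bigcap_(n in `I_m) [set x : Om | x.2 n = ext l n])).
  apply: bigcup_countType => l; apply: measurableI.
    have [h|h] := pselect (size l = m /\ P (ext l)).
      by rewrite (_ : [set _ | _] = setT)//; apply/seteqP; split.
    by rewrite (_ : [set _ | _] = set0)//; apply/seteqP; split.
  by apply: fin_bigcap_measurable => // n _; exact: measurable_digit.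
apply/seteqP; split=> [x Px|x [l _ [[lm Pl]]]].
  exists (mkseq (fun n => x.2 n : 'I_p) m) => //; split.
    split; first by rewrite size_mkseq.
    by apply: Pm Px => l lm; rewrite /ext nth_mkseq.
  by move=> n /= nm; rewrite /ext nth_mkseq.
by move=> h /=; apply: Pm Pl => n nm; rewrite h.
Qed.

Lemma measurable_fits m k : measurable [set x : Om | fits m k x.2].
Proof.
apply: (@measurable_digits (fits m k) m) => i s h.
by rewrite /fits (eq_pval h).
Qed.

(** Once a level m is known at which the addition fits, the new digit n depends on
finitely many digits only. *)
Lemma measurable_s k n j : measurable [set x : Om | s_ R k x.2 n = j].
Proof.
rewrite (_ : [set _ | _] =
  \bigcup_m [set x : Om | fits m k x.2 /\ add_digits m k x.2 n = j] `|`
  ([set x : Om | x.2 n = j] `&` \bigcap_m ~` [set x : Om | fits m k x.2])).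
  apply: measurableU; last first.
    apply: measurableI; first exact: measurable_digit.
    by apply: bigcapT_measurable => m; apply: measurableC; exact: measurable_fits.
  apply: bigcupT_measurable => m.
  apply: (@measurable_digits (fun i => fits m k i /\ add_digits m k i n = j)
    (maxn m n.+1)) => i s h [fi <-].
  have e : pval m i = pval m s.
    by apply: eq_pval => l lm; apply: h; rewrite leq_max lm.
  split; first by rewrite /fits -e.
  by rewrite /add_digits e; case: ifP => // _; rewrite h// leq_max ltnSn orbT.
apply/seteqP; split=> [x /= sj|x].
  have [[m fm]|nf] := pselect (exists m, fits m k x.2).
    by left; exists m => //=; rewrite -(s_fits R fm).
  right; split; last by move=> m _ fm; apply: nf; exists m.
  by rewrite -sj s_nofits// => m fm; apply: nf; exists m.
case=> [[m _ [fm <-]]|[xj nf]] /=; first by rewrite (s_fits R fm).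
by rewrite s_nofits// => m fm; exact: (nf m).
Qed.

Lemma measurable_nuhat :
  measurable_fun [set: Om] ((fun x => nuhat x) : Om -> borel (radon R)).
Proof.
apply: (@continuous_borel (mstar R * one_sided q)%type (radon R) (fun x => nuhat x)).
move=> x.
apply: (@continuous_comp _ _ _ fst (fun y : mstar R => set_val y : radon R)).
  exact: cvg_fst.
exact: initial_continuous.
Qed.

Lemma measurable_mass (a b : R) :
  measurable_fun [set: Om] (fun x : Om => nuhat x `[a, b[%classic).
Proof. exact: (measurableT_comp (measurable_eval a b) measurable_nuhat). Qed.

Lemma measurable_image g g' (cg : continuous g) (cg' : continuous g')
    (gK : cancel g g') (g'K : cancel g' g) :
  measurable_fun [set: Om] ((fun x => to_mstar
     (radon_image (nuhat x) cg cg' gK g'K)) : Om -> borel (mstar R)).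
Proof.
apply: measurable_to_mstar.
have mr := continuous_borel (@continuous_radon_image _ _ _ cg cg' gK g'K).
exact: (measurableT_comp mr measurable_nuhat).
Qed.

Lemma measurable_T_ k : measurable_fun [set: Om] (@T_ R q k).
Proof.
apply: measurable_fun_omega_minus; last by move=> n j; exact: measurable_s.
exact: measurable_image.
Qed.

(** The past of M_p, when the next digit is j. *)
Definition extend j x : Om := (to_mstar (rho_image j (nuhat x)), dcons j x.2).

Lemma measurable_extend j : measurable_fun [set: Om] (extend j).
Proof.
apply: measurable_fun_omega_minus; first exact: measurable_image.
case=> [|n] j'; last exact: measurable_digit.
have [->|jj'] := pselect (j = j').
  by rewrite (_ : [set _ | _] = setT)//; apply/seteqP; split.
by rewrite (_ : [set _ | _] = set0)//; apply/seteqP; split.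
Qed.

Lemma past_M_p (w : omega_Z R q) : past (M_p w) = extend (w.2 1) (past w).
Proof.
rewrite /past /M_p /extend /=; congr (_, _).
apply/funext => -[|n]; rewrite /= /shift //=.
by congr (w.2 _); lia.
Qed.

Lemma continuous_past :
  continuous ((fun w => (w.1, fun k : nat => w.2 (- k%:Z))) :
    (mstar R * two_sided q)%type -> (mstar R * one_sided q)%type).
Proof.
have c2 : continuous ((fun w => fun k : nat => w.2 (- k%:Z)) :
    (mstar R * two_sided q)%type -> {ptws nat -> digit q}).
  apply: continuous_ptws => n w.
  apply: (@continuous_comp _ _ _ snd (fun i : two_sided q => i (- n%:Z))).
    exact: cvg_snd.
  exact: (@proj_continuous int (fun=> digit q)).
have c1 : continuous (fst : (mstar R * two_sided q)%type -> mstar R).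
  by move=> w; exact: cvg_fst.
move=> w.
exact: (@cvg_pair _ _ _ _ _ _ _ _ _ _ _ (c1 w) (c2 w)).
Qed.

Lemma measurable_past : measurable_fun [set: omega_Z R q] (@past R q).
Proof. exact: (continuous_borel continuous_past). Qed.

(** A one-sided sequence extends to a two-sided one by reflection. *)
Lemma XtildeP x : Xtilde x <-> unsettled x.2.
Proof.
split=> [[w wX <-] j [m mj]|xu].
  apply: (wX j); exists (- m%:Z) => n nm.
  have -> : n = - (`|n|%N)%:Z by lia.
  by apply: mj; lia.
exists (x.1, (fun n : int => x.2 `|n|%N)).
  move=> j [m mj]; apply: (xu j); exists `|m|%N => l ml /=.
  by have := mj (- l%:Z); rewrite /= abszN absz_nat; apply; lia.
rewrite /past/=; case: x xu => nu i /= _; congr (_, _).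
by apply/funext => l; rewrite abszN absz_nat.
Qed.

Lemma measurable_Xtilde : measurable (@Xtilde R q).
Proof.
rewrite (_ : @Xtilde R q = \bigcap_(j : 'I_p) \bigcap_m
    \bigcup_(l in [set l | (m <= l)%N]) ~` [set x : Om | x.2 l = j]).
  apply: fin_bigcap_measurable => // j _; apply: bigcapT_measurable => m.
  by apply: bigcup_measurable => l _; apply: measurableC; exact: measurable_digit.
apply/seteqP; split=> x.
  move=> /XtildeP xu j _ m _; apply: contrapT => h; apply: (xu j); exists m => l ml.
  by apply: contrapT => xl; apply: h; exists l.
move=> h; apply/XtildeP => j [m mj]; have [l ml] := h j I m I.
by apply => /=; exact: mj.
Qed.

Lemma measurable_Ytilde : measurable (@Ytilde R q).
Proof.
rewrite (_ : @Ytilde R q = @Xtilde R q `&`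
  (fun x => nuhat x (@unit_itv R)) @^-1` (~` [set 0%E])); last by apply/seteqP; split.
apply: measurableI; first exact: measurable_Xtilde.
by have := @measurable_mass 0 1 measurableT (~` [set 0%E]); rewrite setTI; apply; exact: measurableC.
Qed.

Lemma preimage_trans (z a b : R) : trans z @^-1` `[a, b[%classic = `[a + z, b + z[%classic.
Proof. by apply/seteqP; split=> y; rewrite /trans /= !in_itv/= lerBrDr ltrBlDr. Qed.

Lemma trans_imageE (z a b : R) (nu : radon R) :
  trans_image z nu `[a, b[%classic = nu `[a + z, b + z[%classic.
Proof. by rewrite -preimage_trans. Qed.

Lemma trans_image_unit (z : R) (nu : radon R) :
  trans_image z nu (@unit_itv R) = nu `[z, z + 1[%classic.
Proof. by rewrite trans_imageE add0r addrC. Qed.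

Lemma measurable_mass_gt0 (a b : R) :
  measurable [set x : Om | (0 < nuhat x `[a, b[%classic)%E].
Proof.
have := @measurable_mass a b measurableT (`]0%:E, +oo%E]%classic : set (\bar R)).
rewrite setTI => /(_ (emeasurable_itv _)); congr measurable;
  apply/seteqP; split=> nu /=; rewrite in_itv/= leey andbT//.
Qed.

Lemma measurable_tau (k : nat) :
  measurable ((fun x : Om => tau (nuhat x)) @^-1` [set k]).
Proof.
refine (@measurable_minN _ Om (fun x n =>
  0 < trans_image (n%:R) (nuhat x) (@unit_itv R))%E _ k) => n.
under eq_set do rewrite trans_image_unit.
exact: measurable_mass_gt0.
Qed.

Lemma measurable_tau_minus (k : nat) :
  measurable ((fun x : Om => tau_minus (nuhat x)) @^-1` [set k]).
Proof.
refine (@measurable_minN _ Om (fun x n =>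
  0 < trans_image (- n%:R) (nuhat x) (@unit_itv R))%E _ k) => n.
under eq_set do rewrite trans_image_unit.
exact: measurable_mass_gt0.
Qed.

Lemma measurable_on_Ytilde (f : Om -> Om) : measurable_fun [set: Om] f ->
  measurable_fun [set: Om] (fun x => if pselect (Ytilde x) then f x else x).
Proof.
move=> mf; rewrite (_ : (fun _ => _) = (fun x => if x \in @Ytilde R q then f x else x)).
  apply: measurable_fun_ifT => //.
  apply: measurable_fun_bool; rewrite setTI.
  have := measurable_Ytilde; congr measurable; apply/seteqP; split=> x /=.
    by move=> Yx; rewrite mem_set.
  by move=> /set_mem.
apply/funext => x; case: pselect => /= Yx; first by rewrite mem_set.
by rewrite memNset.
Qed.

Lemma measurable_T : measurable_fun [set: Om] (@T R q).
Proof.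
apply: measurable_on_Ytilde.
apply: (@measurable_fun_piecewise _ _ Om Om (fun x => tau (nuhat x))
  (fun n => T_ n%:Z)); first exact: measurable_tau.
by move=> n; exact: measurable_T_.
Qed.

Lemma measurable_T_inv : measurable_fun [set: Om] (@T_inv R q).
Proof.
apply: measurable_on_Ytilde.
apply: (@measurable_fun_piecewise _ _ Om Om (fun x => tau_minus (nuhat x))
  (fun n => T_ (- n%:Z))); first exact: measurable_tau_minus.
by move=> n; exact: measurable_T_.
Qed.

Lemma measurable_phi : measurable_fun [set: Om] (@phi R q).
Proof.
apply: (@measurable_fun_piecewise _ _ Om _ (fun x => tau (nuhat x))
  (fun n x => nuhat x `[n%:R, n%:R + 1[%classic)); first exact: measurable_tau.
by move=> n; exact: measurable_mass.
Qed.

End omega_minus_measurability.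

(** * Integrals of weighted pullbacks *)

Section weighted_pullback.
Local Open Scope ereal_scope.
Import HBNNSimple.
Context d d' (T : measurableType d) (S : measurableType d') (R : realType).
Variables (mu : {measure set T -> \bar R}) (u : T -> S) (a : T -> \bar R).
Hypotheses (mu_u : measurable_fun [set: T] u) (ma : measurable_fun [set: T] a).
Hypotheses (a0 : forall x, 0 <= a x) (afin : forall x, a x \is a fin_num).

(** The simple function h takes the values r on the sets h @^-1` [set r]; the
sum defining sintegral is that of the integrals over their preimages. *)
Lemma integral_pullback_nnsfun (h : {nnsfun S >-> R}) :
  \int[mu]_x ((h (u x))%:E * a x) =
  sintegral (fun B => \int[mu]_(x in u @^-1` B) a x) h.
Proof.
have mh r : measurable (h @^-1` [set r]) by exact: measurable_sfunP.
rewrite /sintegral -(fsbig_widen (range h) setT)//=; last first.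
  move=> r [_ /= hr]; rewrite (_ : h @^-1` [set r] = set0).
    by rewrite preimage_set0 integral_set0 mule0.
  by apply/seteqP; split=> // y /= hy; apply: hr; exists y.
have hE x : (h (u x))%:E * a x =
    \sum_(r \in range h) ((r * \1_(h @^-1` [set r]) (u x))%:E * a x).
  rewrite -ge0_mule_fsuml => [|r]; last exact: nnfun_muleindic_ge0.
  by rewrite fsumEFin // -(fimfunE _ (u x)).
under eq_integral do rewrite hE.
rewrite ge0_integral_fsum//; last 2 first.
- move=> r; apply: emeasurable_funM => //; apply/measurable_EFinP.
  apply: measurable_funM => //; apply: measurableT_comp mu_u.
  exact: measurable_indic.
- by move=> r x _; rewrite mule_ge0// nnfun_muleindic_ge0.
apply: eq_fsbigr => r; rewrite inE => -[y _ <-].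
under eq_integral do rewrite EFinM -muleA.
rewrite ge0_integralZl//; last 3 first.
- apply: emeasurable_funM => //; apply/measurable_EFinP.
  by apply: measurableT_comp mu_u; exact: measurable_indic.
- by move=> x _; rewrite mule_ge0// lee_fin.
- by rewrite lee_fin.
congr (_ * _); rewrite [RHS]integral_mkcond; apply: eq_integral => x _.
by rewrite epatch_indic muleC /= !indicE.
Qed.

(** The right-hand side depends on mu, u and a only through the set function
B |-> \int[mu]_(x in u @^-1` B) a x. Two weighted maps with the same set
function therefore integrate all functions alike. *)
Lemma integral_pullback (g : S -> \bar R) (mg : measurable_fun [set: S] g) :
  (forall y, 0 <= g y) ->
  \int[mu]_x (g (u x) * a x) =
  limn (fun n => sintegral (fun B => \int[mu]_(x in u @^-1` B) a x)
                           (nnsfun_approx measurableT mg n)).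
Proof.
move=> g0.
pose h := nnsfun_approx measurableT mg.
under [in RHS]eq_fun do rewrite -integral_pullback_nnsfun.
rewrite -monotone_convergence//.
- apply: eq_integral => x _; apply/esym/cvg_lim => //.
  by apply: cvgeZr => //; exact: (cvg_nnsfun_approx measurableT mg).
- move=> n; apply: emeasurable_funM => //; apply/measurable_EFinP.
  exact: measurableT_comp mu_u.
- by move=> n x _; rewrite mule_ge0// lee_fin.
- move=> x _ m n mn; rewrite lee_wpmul2r// lee_fin.
  exact/lefP/nd_nnsfun_approx.
Qed.
End weighted_pullback.

Section eq_weighted_pullback.
Import HBNNSimple.

Lemma eq_integral_pullback d1 d2 d' (T1 : measurableType d1)
    (T2 : measurableType d2) (S : measurableType d') (R : realType)
    (m1 : {measure set T1 -> \bar R}) (m2 : {measure set T2 -> \bar R})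
    (u : T1 -> S) (v : T2 -> S) (a : T1 -> \bar R) (b : T2 -> \bar R) :
  measurable_fun [set: T1] u -> measurable_fun [set: T2] v ->
  measurable_fun [set: T1] a -> measurable_fun [set: T2] b ->
  (forall x, (0 <= a x)%E) -> (forall x, a x \is a fin_num) ->
  (forall x, (0 <= b x)%E) -> (forall x, b x \is a fin_num) ->
  (forall B, measurable B -> (\int[m1]_(x in u @^-1` B) a x =
                              \int[m2]_(x in v @^-1` B) b x)%E) ->
  forall g : S -> \bar R, measurable_fun [set: S] g -> (forall y, 0 <= g y)%E ->
  (\int[m1]_x (g (u x) * a x) = \int[m2]_x (g (v x) * b x))%E.
Proof.
move=> mu mv ma mb a0 af b0 bf ab g mg g0.
rewrite (integral_pullback m1 mu ma a0 af mg g0).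
rewrite (integral_pullback m2 mv mb b0 bf mg g0).
congr (limn _); apply/funext => n; apply: eq_fsbigr => r _; congr (_ * _)%E.
by apply: ab; exact: measurable_sfunP.
Qed.
End eq_weighted_pullback.

(** * The law of the past after one more digit *)

Section transfer.
Variables (R : realType) (q : nat).
Local Notation p := q.+2.
Local Notation Om := (omega_minus R q).
Local Notation OZ := (omega_Z R q).
Local Open Scope ereal_scope.
Implicit Types (j : digit q) (x : Om) (w : OZ).
Variable Q : probability OZ R.

Definition past_law : {measure set Om -> \bar R}.
Proof.
unshelve refine (pushforward Q (@past R q) : {measure set Om -> \bar R}).
exact: measurable_past.
Defined.

Lemma past_lawE (A : set Om) : past_law A = Q (@past R q @^-1` A).
Proof. by []. Qed.

Lemma past_lawT : past_law [set: Om] = 1.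
Proof. by rewrite past_lawE preimage_setT probability_setT. Qed.

Lemma preimage_past (B : set Om) : measurable B ->
  measurable (@past R q @^-1` B).
Proof. by move=> mB; rewrite -[_ @^-1` _]setTI; exact: measurable_past. Qed.

Lemma integral_past (B : set Om) (g : Om -> \bar R) :
  measurable B -> measurable_fun [set: Om] g -> (forall x, 0 <= g x) ->
  \int[past_law]_(x in B) g x = \int[Q]_(w in @past R q @^-1` B) g (past w).
Proof.
move=> mB mg g0; apply: (ge0_integral_pushforward (@measurable_past R q)) => //.
exact: measurable_funTS.
Qed.

Lemma measurable_next_digit j : measurable (@next_digit_is R q j).
Proof.
apply: measurable_open.
have c : continuous ((fun w => w.2 1%R) : (mstar R * two_sided q)%type -> digit q).
  move=> x; apply: (@continuous_comp _ _ _ snd (fun i : two_sided q => i 1%R)).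
    exact: cvg_snd.
  exact: (@proj_continuous int (fun=> digit q)).
by move/continuousP : c => /(_ [set j]); apply; exact: discrete_open.
Qed.

Definition digit_mass x j := nuhat x (@digit_itv R q j).

Lemma measurable_digit_mass j : measurable_fun [set: Om] (digit_mass ^~ j).
Proof. exact: measurable_mass. Qed.

Lemma digit_mass_fin x j : digit_mass x j \is a fin_num.
Proof. exact: radon_itv_num. Qed.

(** Adaptedness in integrated form. *)
Lemma next_digit_law j (B : set Om) : adapted Q -> measurable B ->
  Q (@past R q @^-1` B `&` next_digit_is j) = \int[past_law]_(x in B) digit_mass x j.
Proof.
move=> aQ mB; have [gc [_ igc gcE] gcae] := aQ j.
have mpB := preimage_past mB.
rewrite integral_past//; last exact: measurable_digit_mass.
rewrite setIC -gcE; last by exists B => //; rewrite setTI.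
apply: ae_eq_integral => //.
- apply: measurable_funTS; exact: measurable_int igc.
- apply: measurable_funTS.
  exact: (measurableT_comp (measurable_digit_mass j) (@measurable_past R q)).
- by move: gcae; apply: filterS => w.
Qed.

(** By invariance the law of the past is that of the past one step later, which
is extend j of the present past when the next digit is j; by adaptedness this
has conditional probability digit_mass x j. *)
Lemma transfer (g : Om -> \bar R) : adapted Q -> Defs.invariant Q (@M_p R q) ->
  measurable_fun [set: Om] g -> (forall x, 0 <= g x) ->
  \int[past_law]_x g x =
  \sum_(j : 'I_p) \int[past_law]_x (g (extend j x) * digit_mass x j).
Proof.
move=> aQ [mM iM] mg g0.
have mgp : measurable_fun [set: OZ] (fun w => g (past w)).
  exact: (measurableT_comp mg (@measurable_past R q)).
rewrite integral_past// preimage_setT.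
pose Q' : {measure set OZ -> \bar R} :=
  ltac:(unshelve refine (pushforward Q (@M_p R q) : {measure set OZ -> \bar R}); exact: mM).
rewrite (eq_measure_integral Q'); last by move=> A mA _; exact: esym (iM A mA).
rewrite (ge0_integral_pushforward mM)// preimage_setT.
pose F j w := g (extend j (past w)) * (\1_(@next_digit_is R q j) w)%:E.
have mgE j : measurable_fun [set: Om] (g \o extend j).
  exact: (measurableT_comp mg (@measurable_extend R q j)).
have mind j : measurable_fun [set: OZ] (fun w => (\1_(@next_digit_is R q j) w)%:E : \bar R).
  apply/measurable_EFinP; apply: measurable_indic; exact: measurable_next_digit.
transitivity (\int[Q]_w (\sum_(j : 'I_p) F j w)).
  apply: eq_integral => w _ /=.
  rewrite (bigD1 (w.2 1%R : 'I_p))//= big1 ?adde0 => [|j jw].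
    by rewrite /F indicE mem_set// mule1 past_M_p.
  rewrite /F indicE memNset ?mule0// => wj; move/eqP : jw; apply.
  by rewrite -wj.
rewrite (@ge0_integral_sum _ _ _ Q setT measurableT 'I_p F); last 2 first.
- move=> j; apply: emeasurable_funM; last exact: mind.
  exact: (measurableT_comp (mgE j) (@measurable_past R q)).
- by move=> j w _; rewrite mule_ge0// lee_fin.
apply: eq_bigr => j _.
apply: (@eq_integral_pullback _ _ _ OZ Om Om R Q past_law (@past R q) id
  (fun w => (\1_(@next_digit_is R q j) w)%:E) (digit_mass ^~ j) _ _ _ _ _ _ _ _ _
  (g \o extend j)) => //.
- exact: measurable_past.
- exact: measurable_digit_mass.
- by move=> x; exact: digit_mass_fin.
- move=> B mB; rewrite preimage_id -next_digit_law//.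
  have mj := measurable_next_digit j; have mpB := preimage_past mB.
  by rewrite setIC -integral_indic.
- by move=> x; exact: g0.
Qed.

End transfer.

(** * Unit intervals and their cells *)

Section cells.
Variables (R : realType) (q : nat).
Local Notation p := q.+2.
Local Notation Om := (omega_minus R q).
Implicit Types (j : digit q) (x y z : Om) (k c : int) (nu : radon R).

Definition umass x k := nuhat x `[k%:~R, k%:~R + 1[%classic.

(** A p-adic interval of the first generation, anywhere on the line: the cells
c = p * k + j with 0 <= j < p tile [k, k + 1). *)
Definition cell_itv c : set R := `[(c%:~R / p%:R)%R, ((c%:~R + 1) / p%:R)%R[.

Definition cell x c := nuhat x (cell_itv c).

Let p_gt0 : (0 < p%:R :> R)%R. Proof. by []. Qed.

Lemma digit_itvE j : @digit_itv R q j = cell_itv (dnat j)%:Z.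
Proof. by rewrite /digit_itv /cell_itv -pmulrn. Qed.

Lemma digit_massE x j : digit_mass x j = cell x (dnat j)%:Z.
Proof. by rewrite /digit_mass digit_itvE. Qed.

Lemma measurable_umass k : measurable_fun [set: Om] (umass ^~ k).
Proof. exact: measurable_mass. Qed.

Lemma measurable_cell c : measurable_fun [set: Om] (cell ^~ c).
Proof. exact: measurable_mass. Qed.

Lemma umass_ge0 x k : (0 <= umass x k)%E. Proof. exact: measure_ge0. Qed.
Lemma cell_ge0 x c : (0 <= cell x c)%E. Proof. exact: measure_ge0. Qed.

Lemma to_mstar_eq nu nu' : normalize nu = normalize nu' -> to_mstar nu = to_mstar nu'.
Proof. by move=> e; apply/val_inj. Qed.

Lemma nuhat_extend j x : nuhat (extend j x) = normalize (rho_image j (nuhat x)).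
Proof. by []. Qed.

Lemma nuhat_T_ k x : nuhat (T_ k x) = normalize (trans_image k%:~R (nuhat x)).
Proof. by []. Qed.

Lemma nuhat_normalize x : normalize (nuhat x) = nuhat x.
Proof.
case: x => nu i; rewrite /nuhat/=.
have [mu _ e] := set_mem (valP nu).
have -> : set_val nu = normalize mu by exact: esym e.
exact: normalizeK.
Qed.

Lemma preimage_rho j k :
  rho j @^-1` (`[k%:~R, k%:~R + 1[%classic : set R) = cell_itv ((dnat j)%:Z + k).
Proof.
apply/seteqP; split=> y; rewrite /rho /cell_itv /= !in_itv/= intrD -pmulrn;
  rewrite ler_pdivrMr// ltr_pdivlMr// -/(dnat j) digit_valE;
  move=> /andP[h1 h2]; apply/andP; split; lra.
Qed.

Lemma rho_imageE j k nu :
  rho_image j nu `[k%:~R, k%:~R + 1[%classic = nu (cell_itv ((dnat j)%:Z + k)).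
Proof. by rewrite -preimage_rho. Qed.

Lemma trans_cell k c nu :
  trans_image k%:~R nu (cell_itv c) = nu (cell_itv (c + p%:Z * k)).
Proof.
have e (a : R) : ((a + p%:R * k%:~R) / p%:R = a / p%:R + k%:~R)%R.
  by rewrite mulrDl mulrAC mulfV ?mul1r// gt_eqF.
by rewrite trans_imageE /cell_itv intrD intrM -pmulrn addrAC !e.
Qed.

Lemma rho_image_unit j nu : rho_image j nu (@unit_itv R) = nu (cell_itv (dnat j)%:Z).
Proof.
have := rho_imageE j 0 nu; rewrite addr0 => <-.
by rewrite /unit_itv add0r.
Qed.

(** extend j magnifies the cell j to [0, 1), so it magnifies the cell j + k to
[k, k + 1); dividing by the mass of the cell j normalizes. *)
Lemma umass_extend j k x : (0 < cell x (dnat j)%:Z)%E ->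
  (umass (extend j x) k * cell x (dnat j)%:Z)%E = cell x ((dnat j)%:Z + k).
Proof.
move=> c0; rewrite /umass nuhat_extend /cell -rho_image_unit normalize_unit ?rho_imageE//.
by rewrite rho_image_unit.
Qed.

Lemma umass_extend_gt0 j k x :
  (0 < umass (extend j x) k)%E = (0 < cell x ((dnat j)%:Z + k)%R)%E.
Proof. by rewrite /umass nuhat_extend normalize_gt0// rho_imageE. Qed.

Lemma cell_T_ c k x : (0 < umass x k)%E ->
  (cell (T_ k x) c * umass x k)%E = cell x (c + p%:Z * k).
Proof.
move=> u0; rewrite /umass -trans_image_unit /cell nuhat_T_.
by rewrite normalize_unit ?trans_cell// trans_image_unit.
Qed.

Lemma cell_T_gt0 c k x : (0 < cell (T_ k x) c)%E = (0 < cell x (c + p%:Z * k)%R)%E.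
Proof.
rewrite /cell nuhat_T_ normalize_gt0 ?trans_cell//; exact: measurable_itv.
Qed.

Lemma umass_T_gt0 l k x : (0 < umass (T_ k x) l)%E = (0 < umass x (l + k)%R)%E.
Proof.
rewrite /umass nuhat_T_ normalize_gt0; last exact: measurable_itv.
by rewrite trans_imageE intrD addrAC.
Qed.

Lemma cell_le_umass x j k : (cell x ((dnat j)%:Z + p%:Z * k)%R <= umass x k)%E.
Proof.
apply: le_measure; rewrite ?inE; [exact: measurable_itv|exact: measurable_itv|].
have jp : ((dnat j)%:R + 1 <= p%:R :> R)%R by rewrite natr1 ler_nat dnat_lt.
have j0 : (0 <= (dnat j)%:R :> R)%R by [].
move=> y; rewrite /cell_itv /= !in_itv/= intrD intrM -!pmulrn.
rewrite ler_pdivrMr// ltr_pdivlMr// => /andP[h1 h2]; apply/andP; split.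
  rewrite -(ler_pM2r p_gt0); lra.
rewrite -(ltr_pM2r p_gt0); lra.
Qed.

Lemma umass0 x : umass x 0 = 0%E \/ umass x 0 = 1%E.
Proof.
have := normalize_unit01 (nuhat x); rewrite nuhat_normalize /umass /unit_itv.
by rewrite add0r.
Qed.

Lemma trans_rho j j' k k' nu : ((dnat j)%:Z + k = (dnat j')%:Z + p%:Z * k') ->
  trans_image k%:~R (rho_image j nu) = rho_image j' (trans_image k'%:~R nu).
Proof.
move=> jk; apply: radon_eqP => A mA.
change (nu ((fun y : R => trans k%:~R (rho j y)) @^-1` A) =
        nu ((fun y : R => rho j' (trans k'%:~R y)) @^-1` A)).
congr (nu (_ @^-1` A)); apply/funext => y /=; rewrite /trans /rho !digit_valE.
have := congr1 (fun i : int => i%:~R : R) jk.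
rewrite !intrD intrM -!pmulrn; lra.
Qed.

Lemma normalize_trans (z : R) nu :
  normalize (trans_image z (normalize nu)) = normalize (trans_image z nu).
Proof. exact: normalize_image. Qed.

Lemma normalize_rho j nu :
  normalize (rho_image j (normalize nu)) = normalize (rho_image j nu).
Proof. exact: normalize_image. Qed.

(** Translating by k after magnifying the cell j is magnifying the cell j' after
translating by the carry k'; on the digits this is s_cons. *)
Lemma T_extend m j j' k k' x : ((dnat j)%:Z + k = (dnat j')%:Z + p%:Z * k') ->
  fits m k' x.2 -> T_ k (extend j x) = extend j' (T_ k' x).
Proof.
move=> jk fx.
have e1 : trans_star k%:~R (nuhat (extend j x)) =
          to_mstar (rho_image j' (nuhat (T_ k' x))).
  apply: to_mstar_eq; rewrite nuhat_extend nuhat_T_ normalize_trans normalize_rho.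
  by rewrite (trans_rho _ jk).
have e2 : s_ R k (extend j x).2 = dcons j' (T_ k' x).2 := s_cons R jk fx.
by rewrite /T_ e1 e2.
Qed.

Lemma omega_minus_eq x y : nuhat x = nuhat y -> x.2 = y.2 -> x = y.
Proof.
case: x y => nu i [nu' i']; rewrite /nuhat /= => e ->; congr (_, _).
exact: val_inj.
Qed.

Lemma trans_image0 nu : trans_image 0 nu = nu.
Proof.
apply: radon_eqP => A mA; rewrite /= /pushforward (_ : trans 0 @^-1` A = A)//.
by apply/seteqP; split=> y /=; rewrite /trans subr0.
Qed.

Lemma trans_imageN (a : R) nu : trans_image (- a) (trans_image a nu) = nu.
Proof.
apply: radon_eqP => A mA.
change (nu ((fun y : R => trans (- a) (trans a y)) @^-1` A) = nu A).
congr (nu _); apply/seteqP; split=> y /=; by rewrite transK.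
Qed.

Lemma T_0 x : T_ 0 x = x.
Proof.
apply: omega_minus_eq; last exact: s_0.
by rewrite nuhat_T_ trans_image0 nuhat_normalize.
Qed.

Lemma T_K m k x : fits m k x.2 -> T_ (- k) (T_ k x) = x.
Proof.
move=> fx; apply: omega_minus_eq; last exact: s_K fx.
by rewrite !nuhat_T_ normalize_trans mulrNz trans_imageN nuhat_normalize.
Qed.

End cells.

(** * Translations of the law of the past *)

Section translation_law.
Variables (R : realType) (q : nat).
Local Notation p := q.+2.
Local Notation Om := (omega_minus R q).
Implicit Types (j : digit q) (x y z : Om) (k c : int) (g : Om -> \bar R).
Variable Q : probability (omega_Z R q) R.
Hypotheses (aQ : adapted Q) (iQ : Defs.invariant Q (@M_p R q)).
Local Notation mu := (past_law Q).

Definition ind (b : bool) : \bar R := (b%:R)%:E.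

Lemma ind_ge0 b : (0 <= ind b)%E. Proof. by case: b; rewrite lee_fin. Qed.

Lemma indT : ind true = 1%E. Proof. by []. Qed.

Lemma ind0 : ind false = 0%E. Proof. by []. Qed.

Lemma measurable_ind (b : Om -> bool) : measurable [set x | b x] ->
  measurable_fun [set: Om] (fun x => ind (b x)).
Proof.
move=> mb; rewrite (_ : (fun _ => _) = (EFin \o \1_[set x | b x])).
  by apply/measurable_EFinP; exact: measurable_indic.
apply/funext => x; rewrite /ind /= indicE; congr ((_ : bool)%:R%:E).
by apply/idP/idP => [bx|/set_mem//]; exact: mem_set.
Qed.

Lemma measurable_ind_fits m k : measurable_fun [set: Om] (fun x => ind (fits m k x.2)).
Proof. apply: measurable_ind; exact: measurable_fits. Qed.

Lemma measurable_ind_mass (a b : R) :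
  measurable_fun [set: Om] (fun x => ind (0 < nuhat x `[a, b[%classic)%E).
Proof. apply: measurable_ind; exact: measurable_mass_gt0. Qed.

Definition shift_digit k (j : 'I_p) : 'I_p :=
  inord (absz (modz ((dnat j)%:Z + k) p)).
Definition carry k (j : 'I_p) : int := divz ((dnat j)%:Z + k) p.

(** Euclidean division of j + k by p. *)
Lemma shift_carry k (j : 'I_p) :
  (dnat j)%:Z + k = (dnat (shift_digit k j))%:Z + p%:Z * carry k j.
Proof.
have p0 : p%:Z != 0 by [].
have e := divz_eq ((dnat j)%:Z + k) p.
have m0 := modz_ge0 ((dnat j)%:Z + k) p0.
have m1 := ltz_pmod ((dnat j)%:Z + k) (erefl : 0 < p%:Z).
rewrite /shift_digit /carry /dnat inordK; last by lia.
by rewrite [LHS]e; lia.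
Qed.

Lemma shift_digit_inj k : injective (shift_digit k).
Proof.
move=> j1 j2 e; have := shift_carry k j1; have := shift_carry k j2; rewrite e.
have := dnat_lt j1; have := dnat_lt j2.
move: (carry k j1) (carry k j2) => c1 c2 l1 l2 h1 h2; apply: dnat_inj.
by have [c|c|c] := ltgtP c1 c2; nia.
Qed.

(** At level 0 only k = 0 fits. At level m + 1, write x = extend j y. Then T_k x =
extend j' (T_k' y) with k' the carry of j + k, and the densities multiply:
both sides become integrals over y of the same kind at level m, for the
translation k', with h in place of g. The digits j and j' = j + k mod p
correspond bijectively. *)
Lemma translation_law_level m k g : measurable_fun [set: Om] g ->
  (forall x, (0 <= g x)%E) ->
  (\int[mu]_x (g (T_ k x) * umass x k * ind (fits m k x.2)) =
   \int[mu]_x (g x * ind (0 < umass x (- k)) * ind (fits m (- k) x.2)))%E.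
Proof.
elim: m k g => [|m IH] k g mg g0.
  apply: eq_integral => x _.
  have [->|k0] := eqVneq k 0.
    rewrite oppr0 T_0; congr (_ * _ * _)%E.
    by case: (umass0 x) => ->; rewrite ?ltxx ?lte01.
  have f0 l : l != 0 -> fits 0 l x.2 = false.
    by move=> l0; apply/negP; rewrite /fits /pval big_ord0 expn0; lia.
  by rewrite !f0 ?oppr_eq0// /ind !mule0.
have mT k' : measurable_fun [set: Om] (fun x => g (T_ k' x)).
  exact: (measurableT_comp mg (@measurable_T_ R q k')).
have mL : measurable_fun [set: Om]
    (fun x => g (T_ k x) * umass x k * ind (fits m.+1 k x.2))%E.
  apply: emeasurable_funM; last exact: measurable_ind_fits.
  by apply: emeasurable_funM => //; exact: measurable_umass.
have mR : measurable_fun [set: Om]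
    (fun x => g x * ind (0 < umass x (- k)) * ind (fits m.+1 (- k) x.2))%E.
  apply: emeasurable_funM; last exact: measurable_ind_fits.
  by apply: emeasurable_funM => //; exact: measurable_ind_mass.
rewrite (transfer aQ iQ mL); last first.
  by move=> x; rewrite !mule_ge0 ?ind_ge0 ?umass_ge0.
rewrite (transfer aQ iQ mR); last first.
  by move=> x; rewrite !mule_ge0 ?ind_ge0.
rewrite [RHS](reindex_inj (@shift_digit_inj k)) /=.
apply: eq_bigr => j _.
set j' := shift_digit k j; set k' := carry k j.
have jk : (dnat j)%:Z + k = (dnat j')%:Z + p%:Z * k' := shift_carry k j.
have jk' : (dnat j')%:Z - k = (dnat j)%:Z + p%:Z * (- k') by lia.
(* The indicator records that the digit j is charged at y = T_(-k') z; it is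
   what remains of the factor digit_mass y j after the division by it. *)
pose h z : \bar R := (g (extend j' z) * cell z (dnat j')%:Z *
  ind (0 < cell z ((dnat j)%:Z + p%:Z * (- k'))%R))%E.
have mh : measurable_fun [set: Om] h.
  apply: emeasurable_funM; last exact: measurable_ind_mass.
  apply: emeasurable_funM; last exact: measurable_cell.
  exact: (measurableT_comp mg (@measurable_extend R q j')).
have h0 z : (0 <= h z)%E by rewrite !mule_ge0// ?ind_ge0 ?cell_ge0.
transitivity (\int[mu]_y (h (T_ k' y) * umass y k' * ind (fits m k' y.2)))%E.
  apply: eq_integral => y _; rewrite digit_massE (fits_cons _ _ jk).
  have [fy|] := boolP (fits m k' y.2); last by rewrite !mule0 mul0e.
  rewrite (T_extend jk fy) /h cell_T_gt0.
  rewrite (_ : _ + p%:Z * - k' + p%:Z * k' = (dnat j)%:Z); last by lia.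
  have := cell_ge0 y (dnat j)%:Z; rewrite le_eqVlt => /predU1P[<-|c0].
    by rewrite ltxx mule0 mule0 !mul0e.
  have E : (umass (extend j y) k * cell y (dnat j)%:Z =
            cell (T_ k' y) (dnat j')%:Z * umass y k')%E.
    rewrite (umass_extend _ c0) jk.
    have := umass_ge0 y k'; rewrite le_eqVlt => /predU1P[u0|u0].
      rewrite -u0 mule0; apply/eqP; rewrite eq_le cell_ge0 u0.
      by rewrite cell_le_umass.
    by rewrite cell_T_.
  rewrite c0 !indT; move: E.
  move: (g _) (umass (extend j y) k) (cell y _) (cell (T_ k' y) _) (umass y k').
  by move=> G a b c d E; rewrite !mule1 -!muleA E.
rewrite IH//; apply: eq_integral => z _; rewrite digit_massE (fits_cons _ _ jk').
rewrite umass_extend_gt0 jk' /h.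
have := cell_ge0 z ((dnat j)%:Z + p%:Z * - k'); rewrite le_eqVlt => /predU1P[<-|c0].
  by rewrite ltxx !mule0 !mul0e.
rewrite c0 (lt_le_trans c0 (cell_le_umass _ _ _)) !indT.
by move: (g _) (cell z _) (ind _) => G a b; rewrite !mule1 muleAC.
Qed.

Lemma translation_law k g : mu (~` @Xtilde R q) = 0%E -> measurable_fun [set: Om] g ->
  (forall x, (0 <= g x)%E) ->
  (\int[mu]_x (g (T_ k x) * umass x k) = \int[mu]_x (g x * ind (0 < umass x (- k))))%E.
Proof.
move=> X0 mg g0.
have aeX : {ae mu, forall x, Xtilde x}.
  exists (~` @Xtilde R q); split => //.
  by apply: measurableC; exact: measurable_Xtilde.
have lim l (f : Om -> \bar R) : measurable_fun [set: Om] f -> (forall x, (0 <= f x)%E) ->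
  (\int[mu]_x (f x * ind (fits m l x.2)) @[m --> \oo] --> \int[mu]_x f x)%E.
  move=> mf f0.
  pose F m := [set x : Om | fits m l x.2].
  have mF m : measurable (F m) by exact: measurable_fits.
  have := @ge0_nondecreasing_set_cvg_integral _ _ _ F f mu.
  rewrite (_ : (\int[mu]_(x in \bigcup_i F i) f x = \int[mu]_x f x)%E); last first.
    rewrite integral_mkcond; apply: ae_eq_integral => //.
      apply/(measurable_restrictT _ (bigcupT_measurable _ mF)).
      exact: measurable_funTS.
    apply: filterS aeX => x Xx _; rewrite patchE mem_set//.
    have [m fm] := @unsettled_fits _ l x.2 ((XtildeP x).1 Xx).
    by exists m.
  rewrite (_ : (fun i => \int[mu]_(x in F i) f x)%E =
               (fun m => \int[mu]_x (f x * ind (fits m l x.2)))%E); last first.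
    apply/funext => m; rewrite integral_mkcond; apply: eq_integral => x _.
    rewrite epatch_indic /= indicE; congr (_ * (_ : bool)%:R%:E)%E.
    by apply/idP/idP => [/set_mem//|]; exact: mem_set.
  apply=> //.
  - move=> m n mn; apply/subsetPset => x; exact: fitsW.
  - by move=> m; exact: measurable_funTS.
have e1 : (\int[mu]_x (g (T_ k x) * umass x k * ind (fits m k x.2)) @[m --> \oo] -->
           \int[mu]_x (g (T_ k x) * umass x k))%E.
  apply: lim => [|x]; last by rewrite mule_ge0// umass_ge0.
  apply: emeasurable_funM; last exact: measurable_umass.
  exact: (measurableT_comp mg (@measurable_T_ R q k)).
have e2 : (\int[mu]_x (g x * ind (0 < umass x (- k)) * ind (fits m (- k) x.2))
             @[m --> \oo] --> \int[mu]_x (g x * ind (0 < umass x (- k))))%E.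
  apply: lim => [|x]; last by rewrite mule_ge0// ind_ge0.
  by apply: emeasurable_funM => //; exact: measurable_ind_mass.
have e : (fun m => \int[mu]_x (g (T_ k x) * umass x k * ind (fits m k x.2)))%E =
    (fun m => \int[mu]_x (g x * ind (0 < umass x (- k)) * ind (fits m (- k) x.2)))%E.
  by apply/funext => m; exact: translation_law_level.
rewrite e in e1.
exact: (cvg_unique _ e1 e2).
Qed.

End translation_law.

(** * Recurrence *)

Lemma ae_forall_fin d (T : measurableType d) (R : realType)
    (m : {measure set T -> \bar R}) (I : finType) (P : I -> T -> Prop) :
  (forall i, {ae m, forall x, P i x}) -> {ae m, forall x, forall i, P i x}.
Proof.
exact: (@filter_forall T I (fun i => [set x | P i x]) (almost_everywhere m)).
Qed.

Section recurrence.
Variables (R : realType) (q : nat).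
Local Notation p := q.+2.
Local Notation Om := (omega_minus R q).
Local Notation OZ := (omega_Z R q).
Implicit Types (j l : digit q) (x y z : Om) (k c d : int).

Lemma cells_add (nu : radon R) c n :
  (\sum_(j < n) nu (@cell_itv R q (c + j%:Z)) =
   nu `[(c%:~R / p%:R)%R, ((c%:~R + n%:R) / p%:R)%R[%classic)%E.
Proof.
have p0 : 0 < (p%:R)^-1 :> R by rewrite invr_gt0.
elim: n => [|n IH].
  by rewrite big_ord0 addr0 set_itvco0 measure0.
rewrite big_ord_recr /= IH -measureU; [|exact: measurable_itv|exact: measurable_itv|].
- congr (nu _); rewrite /cell_itv intrD -!pmulrn -[n.+1%:R]natr1 addrA.
  apply: esym; apply: itv_bndbnd_setU; rewrite bnd_simp ler_pM2r//; last by rewrite lerDl.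
  by rewrite lerDl.
- apply/seteqP; split=> // y []; rewrite /cell_itv /= !in_itv/= intrD -pmulrn.
  by move=> /andP[_ h] /andP[h' _]; move: (lt_le_trans h h'); rewrite ltxx.
Qed.

(** The cells p * k, ..., p * k + p - 1 are adjacent. *)
Lemma umass_cells x k :
  umass x k = (\sum_(j < p) cell x (j%:Z + p%:Z * k)%R)%E.
Proof.
under eq_bigr do rewrite /cell addrC.
rewrite cells_add /umass; congr (nuhat x _).
have p0 : p%:R != 0 :> R by rewrite pnatr_eq0.
have e (a b : R) : a != 0 -> (a * b / a = b) * ((a * b + a) / a = b + 1).
  by move=> a0; split; field.
by rewrite intrM -pmulrn !e.
Qed.

Variable Q : probability OZ R.
Hypotheses (aQ : adapted Q) (iQ : Defs.invariant Q (@M_p R q)).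
Local Notation mu := (past_law Q).

(** A normalized measure gives mass 0 or 1 to [0, 1), and the mean of this mass
is the total probability of the next digit. *)
Lemma unit_mass_ae : {ae mu, forall x, umass x 0 = 1%E}.
Proof.
have m1 : (\int[mu]_x umass x 0 = 1)%E.
  transitivity (\int[mu]_x cst 1%E x)%E; last first.
    by rewrite integral_cst// mul1e past_lawT.
  rewrite (transfer aQ iQ (measurable_cst 1%E))//.
  rewrite -(@ge0_integral_sum _ _ _ mu setT measurableT 'I_p
    (fun j x => cst 1%E (extend j x) * digit_mass x j)%E); last 2 first.
  - by move=> j; apply: emeasurable_funM => //; exact: measurable_digit_mass.
  - by move=> j x _; rewrite mul1e.
  apply: eq_integral => x _; rewrite umass_cells; apply: eq_bigr => j _.
  by rewrite mul1e digit_massE mulr0 addr0.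
have mY : measurable [set x : Om | (0 < umass x 0)%E] by exact: measurable_mass_gt0.
have muY : mu [set x : Om | (0 < umass x 0)%E] = 1%E.
  rewrite -m1 -[X in mu X]setIT -integral_indic//.
  apply: eq_integral => x _; rewrite indicE.
  have [h|h] := umass0 x; rewrite h.
    by rewrite memNset//= h ltxx.
  by rewrite mem_set//= h.
exists (~` [set x : Om | (0 < umass x 0)%E]); split.
- exact: measurableC.
- rewrite past_lawE preimage_setC probability_setC; last exact: preimage_past mY.
  by rewrite [X in (_ - X)%E]muY subee.
- move=> x /=; have [->|->] := umass0 x => //.
  by rewrite ltxx.
Qed.

Lemma ae_past (P : Om -> Prop) :
  {ae mu, forall x, P x} -> {ae Q, forall w, P (past w)}.
Proof.
move=> [N [mN N0 PN]]; exists (@past R q @^-1` N); split=> //.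
  exact: preimage_past.
by move=> w; exact: PN.
Qed.

(** A digit of mass 0 has conditional probability 0. *)
Lemma next_digit_charged :
  {ae Q, forall w, (0 < cell (past w) (dnat (w.2 1%R))%:Z)%E}.
Proof.
suff H (j : 'I_p) : {ae Q, forall w, w.2 1 = j -> (0 < cell (past w) (dnat j)%:Z)%E}.
  by have := ae_forall_fin H; apply: filterS => w h; exact: (h (w.2 1 : 'I_p) erefl).
have m0 : measurable [set x : Om | cell x (dnat j)%:Z = 0%E].
  have := @measurable_cell R q (dnat j)%:Z measurableT [set 0%E] (emeasurable_set1 _).
  by rewrite setTI.
exists (@past R q @^-1` [set x | cell x (dnat j)%:Z = 0%E] `&` next_digit_is j); split.
- by apply: measurableI; [exact: preimage_past|exact: measurable_next_digit].
- rewrite next_digit_law//; apply: integral0_eq => x /= x0.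
  by rewrite digit_massE.
- move=> w /= /not_implyP[wj /negP]; rewrite -leNgt => c0; split=> //.
  by apply/eqP; rewrite eq_le c0 cell_ge0.
Qed.

(** Replace A by the intersection of its iterated preimages: this is strictly
invariant, and has the same measure since all of the preimages do. *)
Lemma subinvariant01 (A : set OZ) : ergodic Q (@M_p R q) -> measurable A ->
  @M_p R q @^-1` A `<=` A -> Q A = 0%E \/ Q A = 1%E.
Proof.
move=> eQ mA MA; have [mM iM] := iQ.
pose F n := iter n (fun B => @M_p R q @^-1` B) A.
have mF n : measurable (F n).
  elim: n => // n IH; rewrite /F iterS -[_ @^-1` _]setTI; exact: mM.
have QF n : Q (F n) = Q A.
  by elim: n => // n <-; rewrite -(iM (F n))//.
have FS n : F n.+1 `<=` F n.
  by elim: n => [|n IH]; [exact: MA|exact: preimage_subset].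
have Fdec m n : (m <= n)%N -> F n `<=` F m.
  elim: n => [|n IH]; first by rewrite leqn0 => /eqP ->.
  rewrite leq_eqVlt => /predU1P[->//|mn].
  exact: subset_trans (FS n) (IH mn).
have mB : measurable (\bigcap_n F n) by exact: bigcapT_measurable.
suff <- : Q (\bigcap_n F n) = Q A.
  apply: eQ => //; rewrite preimage_bigcap; apply/seteqP; split=> w Fw n _.
    by apply: FS; exact: Fw.
  exact: (Fw n.+1).
have cv : Q (F n) @[n --> \oo] --> Q (\bigcap_n F n).
  apply: nonincreasing_cvg_mu => //.
    by rewrite (le_lt_trans (probability_le1 _ _))// ltry.
  by move=> m n mn; apply/subsetPset; exact: Fdec.
apply: (cvg_unique _ cv) => //.
by rewrite (_ : (fun n => Q (F n)) = cst (Q A)); [exact: cvg_cst|exact/funext].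
Qed.

(** For d = 1 (resp. d = -1) the integers d * n.+1 run through the unit intervals
to the right (resp. left) of [0, 1), so that these are the points at which tau
(resp. tau_minus) is infinite. *)
Definition uncharged_side d : set Om :=
  [set x | forall n : nat, umass x (d * n.+1%:Z) = 0%E].

Lemma measurable_uncharged_side d : measurable (uncharged_side d).
Proof.
rewrite (_ : uncharged_side d = \bigcap_n [set x | umass x (d * n.+1%:Z) = 0%E]).
  apply: bigcapT_measurable => n.
  have := @measurable_umass R q (d * n.+1%:Z) measurableT [set 0%E] (emeasurable_set1 _).
  by rewrite setTI.
by apply/seteqP; split=> [x h n _|x h n]; exact: h.
Qed.

Lemma extend_uncharged_cell d j x n : uncharged_side d (extend j x) ->
  cell x ((dnat j)%:Z + d * n.+1%:Z) = 0%E.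
Proof.
move=> /(_ n) u0; apply/eqP; rewrite eq_le cell_ge0 andbT leNgt.
by rewrite -umass_extend_gt0 u0 ltxx.
Qed.

(** The unit intervals of x to the right of [0, 1) consist of cells to the right
of the cell j, and the latter are magnified to unit intervals of extend j x. *)
Lemma uncharged_side_extend d j x : d = 1 \/ d = -1 ->
  uncharged_side d (extend j x) -> uncharged_side d x.
Proof.
move=> d1 h n; rewrite umass_cells big1// => l _.
(* The cell l of this unit interval lies beyond j, in the direction d, since
     l and j differ by less than p. *)
have [m e] : exists m : nat, l%:Z + p%:Z * (d * n.+1%:Z) = (dnat j)%:Z + d * m.+1%:Z.
  have lp := ltn_ord l; have jp := dnat_lt j.
  case: d1 => ->; [exists (l + p * n.+1 - dnat j).-1|exists (dnat j + p * n.+1 - l).-1]; nia.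
by rewrite e; exact: extend_uncharged_cell.
Qed.

(** If M_p w lies almost surely in this set, then almost surely no cell of [0, 1)
beyond the next digit, in the direction d, is charged. So the digit j cannot
come next when a cell beyond j is charged; having then conditional probability
0, j has mass 0. Two distinct digits are thus never both charged, and the one
that occurs carries the whole mass 1. *)
Lemma uncharged_side_deterministic d : d = 1 \/ d = -1 ->
  mu (uncharged_side d) = 1%E -> deterministic Q.
Proof.
move=> d1 D1.
have [mM iM] := iQ.
have mpc c : measurable [set x : Om | (0 < cell x c)%E] by exact: measurable_mass_gt0.
have MD1 : Q (~` (@M_p R q @^-1` (@past R q @^-1` uncharged_side d))) = 0%E.
  have mD := preimage_past (measurable_uncharged_side d).
  rewrite probability_setC; last by rewrite -[X in measurable X]setTI; exact: mM.
  by have := iM _ mD; rewrite /pushforward => ->; rewrite -past_lawE D1 subee.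
have excl0 j l : (exists n : nat, (dnat l)%:Z = (dnat j)%:Z + d * n.+1%:Z) ->
    {ae mu, forall x, (0 < cell x (dnat l)%:Z)%E -> cell x (dnat j)%:Z = 0%E}.
  move=> [n ln].
  have I0 : (\int[mu]_(x in [set x | (0 < cell x (dnat l)%:Z)%E])
      `|cell x (dnat j)%:Z| = 0)%E.
    under eq_integral do rewrite (gee0_abs (cell_ge0 _ _)) -digit_massE.
    rewrite -next_digit_law//; apply: (subset_measure0 _ _ _ MD1).
    - apply: measurableI; [exact: preimage_past|exact: measurable_next_digit].
    - apply: measurableC; rewrite -[X in measurable X]setTI; apply: mM => //.
      by apply: preimage_past; exact: measurable_uncharged_side.
    - move=> w [/= c0 wj] /= dw; move: c0; rewrite ln.
      by move: dw; rewrite past_M_p wj => /extend_uncharged_cell ->; rewrite ltxx.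
  have mc : measurable_fun [set x : Om | (0 < cell x (dnat l)%:Z)%E]
      (fun x : Om => cell x (dnat j)%:Z).
    by apply: measurable_funTS; exact: measurable_cell.
  exact: ((ae_eq_integral_abs mu (mpc _) mc).1 I0).
have excl : {ae mu, forall x, forall l j : 'I_p, l <> j ->
    (0 < cell x (dnat l)%:Z)%E -> cell x (dnat j)%:Z = 0%E}.
  apply: ae_forall_fin => l; apply: ae_forall_fin => j.
  have [lj|lj] := pselect (l = j); first by apply: aeW => x /(_ lj).
  have [h|h] : (exists n : nat, (dnat l)%:Z = (dnat j)%:Z + d * n.+1%:Z) \/
               (exists n : nat, (dnat j)%:Z = (dnat l)%:Z + d * n.+1%:Z).
    have [lt|gt|/dnat_inj/esym//] := ltngtP (dnat j) (dnat l).
      by case: d1 => ->; [left|right]; exists (dnat l - dnat j).-1; lia.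
    by case: d1 => ->; [right|left]; exists (dnat j - dnat l).-1; lia.
    by have := excl0 j l h; apply: filterS => x + _.
  have := excl0 l j h; apply: filterS => x xh _ c0.
  apply/eqP; rewrite eq_le cell_ge0 andbT leNgt; apply/negP => /xh cl.
  by rewrite cl ltxx in c0.
have [gc gcP] := choice (fun j => (exists2P _ _).1 (aQ j)).
exists gc => [j|]; first by have [] := gcP j.
have gcE : {ae Q, forall w, forall j : 'I_p, gc j w = nuhat w (@digit_itv R q j)}.
  by apply: ae_forall_fin => j; have [] := gcP j.
apply: filterS3 gcE next_digit_charged (ae_past (filterI unit_mass_ae excl)).
move=> w gcw cw [uw ew]; rewrite gcw.
rewrite -[LHS]/(digit_mass (past w) (w.2 1)) digit_massE.
move: uw; rewrite umass_cells (bigD1 (w.2 1 : 'I_p))//= big1.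
  by rewrite adde0 mulr0 addr0.
move=> j jw; rewrite mulr0 addr0.
by apply: (ew (w.2 1 : 'I_p) j) => // wj; rewrite wj eqxx in jw.
Qed.

(** Zero-one law for a set that is stable under going back in time. *)
Lemma uncharged_side_null d : d = 1 \/ d = -1 ->
  ergodic Q (@M_p R q) -> ~ deterministic Q ->
  mu (uncharged_side d) = 0%E.
Proof.
move=> d1 eQ nd.
have := @subinvariant01 (@past R q @^-1` uncharged_side d) eQ
    (preimage_past (measurable_uncharged_side d)).
case=> [w|//|D1]; first by rewrite /= past_M_p; exact: uncharged_side_extend.
by exfalso; apply: nd; exact: uncharged_side_deterministic D1.
Qed.

End recurrence.

(** * The first return *)

Section first_return.
Variables (R : realType) (q : nat).
Local Notation p := q.+2.
Local Notation Om := (omega_minus R q).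
Local Notation OZ := (omega_Z R q).
Implicit Types (x y z : Om) (k : int).

Lemma tauE x : tau (nuhat x) = minN (fun n => (0 < umass x n%:Z)%E).
Proof.
by congr minN; apply/funext => n; rewrite trans_image_unit /umass -pmulrn.
Qed.

Lemma tau_minusE x : tau_minus (nuhat x) = minN (fun n => (0 < umass x (- n%:Z))%E).
Proof.
by congr minN; apply/funext => n; rewrite trans_image_unit /umass mulrNz -pmulrn.
Qed.

Lemma phiE x : phi x = umass x (tau (nuhat x))%:Z.
Proof. by rewrite /phi /umass -pmulrn. Qed.

(** On such points T and its inverse are given by their formulas, and the
return times are finite. *)
Definition recurrent x :=
  [/\ Xtilde x, umass x 0 = 1%E, (0 < tau (nuhat x))%N & (0 < tau_minus (nuhat x))%N].

Lemma YtildeE x : Xtilde x -> (0 < umass x 0)%E -> Ytilde x.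
Proof.
move=> Xx u0; split=> //; rewrite /unit_itv => u1.
by move: u0; rewrite /umass mulr0z add0r u1 ltxx.
Qed.

Lemma Xtilde_T_ k x : Xtilde x -> Xtilde (T_ k x).
Proof. by move=> /XtildeP xu; apply/XtildeP; exact: s_unsettled. Qed.

Lemma Xtilde_T_K k x : Xtilde x -> T_ (- k) (T_ k x) = x.
Proof. by move=> /XtildeP /(@unsettled_fits _ k)[m]; exact: T_K. Qed.

(** Seen from T_n x, the interval [0, 1) of x lies n steps to the left and the
intervals strictly between keep their charge. *)
Lemma tau_minus_T_ x n : (0 < n)%N -> (0 < umass x 0)%E ->
  (tau_minus (nuhat (T_ n%:Z x)) = n <->
   forall m, (0 < m < n)%N -> ~ (0 < umass x m%:Z)%E).
Proof.
move=> n0 u0; rewrite tau_minusE minN_eq// umass_T_gt0 addNr.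
split=> [[_ h] m /andP[m0 mn]|h].
  have := h (n - m)%N; rewrite umass_T_gt0.
  by rewrite (_ : - (n - m)%N%:Z + n%:Z = m%:Z); [apply|]; lia.
split=> // m /andP[m0 mn]; rewrite umass_T_gt0.
by rewrite (_ : - m%:Z + n%:Z = (n - m)%N%:Z); [apply: h|]; lia.
Qed.

Lemma tau_T_ x n : (0 < n)%N -> (0 < umass x 0)%E ->
  (tau (nuhat (T_ (- n%:Z) x)) = n <->
   forall m, (0 < m < n)%N -> ~ (0 < umass x (- m%:Z))%E).
Proof.
move=> n0 u0; rewrite tauE minN_eq// umass_T_gt0 subrr.
split=> [[_ h] m /andP[m0 mn]|h].
  have := h (n - m)%N; rewrite umass_T_gt0.
  by rewrite (_ : (n - m)%N%:Z - n%:Z = - m%:Z); [apply|]; lia.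
split=> // m /andP[m0 mn]; rewrite umass_T_gt0.
by rewrite (_ : m%:Z - n%:Z = - (n - m)%N%:Z); [apply: h|]; lia.
Qed.

Lemma T_recurrent x : recurrent x -> T x = T_ (tau (nuhat x))%:Z x.
Proof.
move=> [Xx u0 _ _]; rewrite /T; case: pselect => //=.
by case; apply: YtildeE => //; rewrite u0.
Qed.

Lemma T_inv_recurrent x : recurrent x -> T_inv x = T_ (- (tau_minus (nuhat x))%:Z) x.
Proof.
move=> [Xx u0 _ _]; rewrite /T_inv; case: pselect => //=.
by case; apply: YtildeE => //; rewrite u0.
Qed.

Lemma T_invK x : recurrent x -> T_inv (T x) = x.
Proof.
move=> rx; rewrite (T_recurrent rx); case: rx => Xx u1 t0 _.
have u0 : (0 < umass x 0)%E by rewrite u1.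
have [tx tmin] := (minN_eq _ t0).1 (esym (tauE x)).
have e := (tau_minus_T_ t0 u0).2 tmin.
rewrite /T_inv; case: pselect => [Yx|nY] /=; first by rewrite e Xtilde_T_K.
exfalso; apply: nY; apply: YtildeE; first exact: Xtilde_T_.
by rewrite umass_T_gt0 add0r.
Qed.

Lemma TK_inv x : recurrent x -> T (T_inv x) = x.
Proof.
move=> rx; rewrite (T_inv_recurrent rx); case: rx => Xx u1 _ t0.
have u0 : (0 < umass x 0)%E by rewrite u1.
have [tx tmin] := (minN_eq _ t0).1 (esym (tau_minusE x)).
have e := (tau_T_ t0 u0).2 tmin.
rewrite /T; case: pselect => [Yx|nY] /=.
  by rewrite e -[X in T_ X _]opprK Xtilde_T_K.
exfalso; apply: nY; apply: YtildeE; first exact: Xtilde_T_.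
by rewrite umass_T_gt0 add0r.
Qed.

Lemma preimage_Xtilde : @past R q @^-1` @Xtilde R q = @Xtilde_Z R q.
Proof.
apply/seteqP; split=> w; last by move=> Xw; exists w.
move=> /XtildeP wu j [m mj]; apply: (wu j); exists `|m|%N => l ml /=.
by apply: mj; lia.
Qed.

Variable Q : probability OZ R.
Hypotheses (hQ : extended_ergodic_CP_distribution Q) (nd : ~ deterministic Q).
Hypothesis hX : Q (@Xtilde_Z R q) = 1%E.
Local Notation mu := (past_law Q).

Let aQ : adapted Q. Proof. by have [] := hQ. Qed.
Let iQ : Defs.invariant Q (@M_p R q). Proof. by have [] := hQ. Qed.
Let eQ : ergodic Q (@M_p R q). Proof. by have [] := hQ. Qed.

Lemma Xtilde_null : mu (~` @Xtilde R q) = 0%E.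
Proof.
have mX := preimage_past (@measurable_Xtilde R q).
have X1 : Q (@past R q @^-1` @Xtilde R q) = 1%E by rewrite preimage_Xtilde.
by rewrite past_lawE preimage_setC probability_setC// [X in (_ - X)%E]X1 subee.
Qed.

Lemma recurrent_ae : {ae mu, forall x, recurrent x}.
Proof.
have aX : {ae mu, forall x, Xtilde x}.
  exists (~` @Xtilde R q); split => //.
  - by apply: measurableC; exact: measurable_Xtilde.
  - exact: Xtilde_null.
have alive d : d = 1 \/ d = -1 -> {ae mu, forall x, ~ uncharged_side d x}.
  move=> d1; exists (@uncharged_side R q d); split.
  - exact: measurable_uncharged_side.
  - exact: (uncharged_side_null aQ iQ d1 eQ nd).
  - by move=> x /= /contrapT.
have a1 := alive 1 (or_introl erefl).
have a2 := alive (-1) (or_intror erefl).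
apply: filterS2 (filterI aX (unit_mass_ae aQ iQ)) (filterI a1 a2).
move=> x [Xx ux] [d1 d2]; split=> //; rewrite lt0n; apply/eqP.
- rewrite tauE => /minN_eq0 h; apply: d1 => n; rewrite mul1r.
  by apply/eqP; rewrite eq_le umass_ge0 andbT leNgt; apply/negP; exact: h.
- rewrite tau_minusE => /minN_eq0 h; apply: d2 => n; rewrite mulN1r.
  by apply/eqP; rewrite eq_le umass_ge0 andbT leNgt; apply/negP; exact: h.
Qed.

Lemma measurable_preimage (f : Om -> Om) (A : set Om) :
  measurable_fun [set: Om] f -> measurable A -> measurable (f @^-1` A).
Proof. by move=> mf mA; rewrite -[_ @^-1` _]setTI; exact: mf. Qed.

(** The translation law for k = n.+1, applied to the indicator of A intersected
with tau_minus = k. On this event the interval [-k, -k + 1) is charged; and if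
[k, k + 1) is charged at x, then tau_minus = k at T_k x exactly when tau = k at
x. Elsewhere both integrands vanish. *)
Lemma return_level (A : set Om) n : measurable A ->
  (mu (A `&` [set x | tau_minus (nuhat x) = n.+1]) =
   \int[mu]_(x in @T R q @^-1` A `&` [set x | tau (nuhat x) = n.+1]) phi x)%E.
Proof.
move=> mA; have mE := @measurable_tau_minus R q n.+1.
have mD := @measurable_tau R q n.+1.
set B := A `&` _.
have mB : measurable B by exact: measurableI.
have mTA := measurable_preimage (@measurable_T R q) mA.
have mTD : measurable (@T R q @^-1` A `&` [set x | tau (nuhat x) = n.+1]).
  exact: measurableI.
have mg : measurable_fun [set: Om] (fun x => ind R (x \in B)).
  apply: measurable_ind; rewrite (_ : [set x | _] = B)//.
  by apply/seteqP; split=> x /= => [/set_mem//|]; exact: mem_set.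
have tl := translation_law aQ iQ n.+1%:Z Xtilde_null mg (fun x => ind_ge0 R _).
transitivity (\int[mu]_x (ind R (x \in B) * ind R (0 < umass x (- n.+1%:Z))))%E.
  rewrite -[B in LHS]setIT -integral_indic//; apply: eq_integral => x _.
  rewrite indicE; case: (boolP (x \in B)) => [/set_mem[_ /= e]|_]; last by rewrite mul0e.
  by have [-> _] := (minN_eq _ (ltn0Sn n)).1 (esym (etrans (esym e) (tau_minusE x))); rewrite mule1.
rewrite -tl [RHS]integral_mkcond; apply: ae_eq_integral => //.
- apply: emeasurable_funM; last exact: measurable_umass.
  exact: (measurableT_comp mg (@measurable_T_ R q n.+1%:Z)).
- by apply/(measurable_restrictT _ mTD); apply: measurable_funTS; exact: measurable_phi.
apply: filterS recurrent_ae => x rx _.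
have [Xx u1 _ _] := rx; have u0 : (0 < umass x 0)%E by rewrite u1.
have iff1 : (0 < umass x n.+1%:Z)%E ->
    tau_minus (nuhat (T_ n.+1%:Z x)) = n.+1 <-> tau (nuhat x) = n.+1.
  by move=> un; rewrite tau_minus_T_// tauE minN_eq//; split=> [|[]].
rewrite patchE; case: ifPn => [/set_mem[/= TA tn]|nD].
  have Tx : T x = T_ n.+1%:Z x by rewrite (T_recurrent rx) tn.
  have un : (0 < umass x n.+1%:Z)%E.
    by have [] := (minN_eq _ (ltn0Sn n)).1 (esym (etrans (esym tn) (tauE x))).
  rewrite phiE tn mem_set ?indT ?mul1e//; split; first by rewrite -Tx.
  by apply/(iff1 un).
have := umass_ge0 x n.+1%:Z; rewrite le_eqVlt => /predU1P[<-|un]; first by rewrite mule0.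
rewrite memNset ?ind0 ?mul0e// => -[/= TA tm]; move/negP: nD; apply; rewrite inE /=.
have tn : tau (nuhat x) = n.+1 by apply/(iff1 un).
by split=> //=; rewrite (T_recurrent rx) tn.
Qed.

Lemma ae_restrict_integral (D D' : set Om) (f : Om -> \bar R) :
  measurable D -> measurable D' -> measurable_fun [set: Om] f ->
  {ae mu, forall x, D x <-> D' x} ->
  (\int[mu]_(x in D) f x = \int[mu]_(x in D') f x)%E.
Proof.
move=> mD mD' mf DD'; rewrite integral_mkcond [RHS]integral_mkcond.
apply: ae_eq_integral => //.
- by apply/(measurable_restrictT _ mD); exact: measurable_funTS.
- by apply/(measurable_restrictT _ mD'); exact: measurable_funTS.
apply: filterS DD' => x xD _; rewrite !patchE.
by congr (if _ then _ else _); apply/idP/idP => /set_mem/xD/mem_set.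
Qed.

(** Almost every point lies in exactly one of the sets tau = k, and in exactly one
of the sets tau_minus = k; sum over k. *)
Lemma return_law (A : set Om) : measurable A ->
  (mu A = \int[mu]_(x in @T R q @^-1` A) phi x)%E.
Proof.
move=> mA; have mTA := measurable_preimage (@measurable_T R q) mA.
pose D n := @T R q @^-1` A `&` [set x | tau (nuhat x) = n.+1].
pose E n := A `&` [set x | tau_minus (nuhat x) = n.+1].
have mD n : measurable (D n) by apply: measurableI => //; exact: measurable_tau.
have mE n : measurable (E n) by apply: measurableI => //; exact: measurable_tau_minus.
have tD : trivIset [set: nat] D.
  by move=> m n _ _ [x [[_ /= e1] [_ /= e2]]]; apply: succn_inj; rewrite -e1 -e2.
have tE : trivIset [set: nat] E.
  by move=> m n _ _ [x [[_ /= e1] [_ /= e2]]]; apply: succn_inj; rewrite -e1 -e2.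
rewrite (@ae_restrict_integral _ (\bigcup_n D n))//; last 3 first.
- exact: bigcupT_measurable.
- exact: measurable_phi.
- apply: filterS recurrent_ae => x [_ _ t0 _]; split=> [TA|[n _ []]//].
  by exists (tau (nuhat x)).-1 => //; split=> //=; rewrite prednK.
rewrite ge0_integral_bigcup//; last first.
  by apply: measurable_funTS; exact: measurable_phi.
transitivity (\int[mu]_(x in A) cst 1 x)%E; first by rewrite integral_cst// mul1e.
rewrite (@ae_restrict_integral _ (\bigcup_n E n))//; last 2 first.
- exact: bigcupT_measurable.
- apply: filterS recurrent_ae => x [_ _ _ t0]; split=> [Ax|[n _ []]//].
  by exists (tau_minus (nuhat x)).-1 => //; split=> //=; rewrite prednK.
rewrite ge0_integral_bigcup//.
apply: eq_eseriesr => n _; rewrite integral_cst// mul1e.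
exact: return_level.
Qed.

Lemma phi_gt0_ae : {ae mu, forall x, (0 < phi x)%E}.
Proof.
apply: filterS recurrent_ae => x [_ _ t0 _]; rewrite phiE.
by have [] := (minN_eq _ t0).1 (esym (tauE x)).
Qed.

(** phi is almost everywhere positive, so the integral in return_law vanishes
exactly when its domain is null. *)
Lemma null_preimage_T (A : set Om) : measurable A ->
  mu A = 0%E <-> mu (@T R q @^-1` A) = 0%E.
Proof.
move=> mA; have mTA := measurable_preimage (@measurable_T R q) mA.
have mphi : measurable_fun (@T R q @^-1` A) (@phi R q).
  by apply: measurable_funTS; exact: measurable_phi.
rewrite (return_law mA); split=> [I0|TA0].
  have I0' : (\int[mu]_(x in @T R q @^-1` A) `|phi x| = 0)%E.
    by under eq_integral do rewrite gee0_abs//.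
  have [N [mN N0 PN]] := filterI phi_gt0_ae ((ae_eq_integral_abs mu mTA mphi).1 I0').
  apply: (subset_measure0 _ _ _ N0) => // x TAx; apply: PN => -[p0 /(_ TAx) p00].
  by rewrite p00 ltxx in p0.
have I0 := integral_abs_eq0 mTA mphi TA0.
by move: I0; under eq_integral do rewrite gee0_abs//.
Qed.

Lemma T_nonsingular : nonsingular mu (@T R q).
Proof.
split; first exact: measurable_T.
- move=> N N0 A mA AN; apply/(null_preimage_T mA); exact: N0.
- move=> N N0 A mA AN; apply/(null_preimage_T mA); exact: N0.
Qed.

Lemma T_inv_ae_inverse : ae_inverse mu (@T R q) (@T_inv R q).
Proof.
split; first exact: measurable_T_inv.
by apply: filterS recurrent_ae => x rx; rewrite T_invK// TK_inv.
Qed.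

(** Almost everywhere T^-1 (T_inv^-1 A) is A. *)
Lemma phi_density : is_density mu (pushforward mu (@T_inv R q)) (@phi R q).
Proof.
split=> [|x|A mA]; first exact: measurable_phi.
- exact: measure_ge0.
have mTA := measurable_preimage (@measurable_T_inv R q) mA.
rewrite /pushforward (return_law mTA).
apply: ae_restrict_integral => //; [|exact: measurable_phi|].
  exact: measurable_preimage (@measurable_T R q) mTA.
by apply: filterS recurrent_ae => x rx; rewrite /= T_invK.
Qed.

End first_return.

Theorem lemma4p5 (R : realType) (q : nat) (Q : probability (omega_Z R q) R)
    (hQ : extended_ergodic_CP_distribution Q)
    (hndet : ~ deterministic Q)
    (hsupp : Q (@Xtilde_Z R q) = 1%E) :
  let Qminus := pushforward Q (@past R q) in
  [/\ nonsingular Qminus (@T R q),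
      ae_inverse Qminus (@T R q) (@T_inv R q) &
      is_density Qminus (pushforward Qminus (@T_inv R q)) (@phi R q)].
Proof.
split.
- exact: T_nonsingular.
- exact: T_inv_ae_inverse.
- exact: phi_density.
Qed.
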